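(* Let $K=\mathbb F_7(t)$, $d=6$, $u=t+1$, and set $c=u^{-(d-1)}=(t+1)^{-5}$. Consider the polynomial $f_c(x)=cx^d+t=(t+1)^{-5}x^6+t$ and the associated twisted Carlitz module $\rho_t^c(x)=tx+cx^7$. Then the arboreal Galois image of $f_c$ is maximal, whereas the full adelic Galois representation of the twisted Carlitz module $\rho_t^c$ is not surjective.
   Context: Maximality of the arboreal Galois image of $f_c$ means: for every $n\ge 1$, $\operatorname{Gal}(\operatorname{Spl}_K(f_c^{\circ n})/K)\cong W_n$, where $f_c^{\circ n}$ is the $n$-fold iterate, $\operatorname{Spl}_K$ denotes the splitting field over $K$, and $W_n=C_d\wr\cdots\wr C_d$ ($n$ factors) is defined by $W_1=C_d$ (cyclic of order $d$) and $W_n=C_d^{S_{n-1}}\rtimes W_{n-1}$ for $n\ge2$, with $S_{n-1}$ the set of vertices at level $n-1$ of the rooted $d$-ary tree and $W_{n-1}$ acting by permuting factors via its natural action on $S_{n-1}$. With $q=7$, the twisted Carlitz module $\rho^c$ is the rank-one Drinfeld $\mathbb F_q[t]$-module over $K$ determined by $\rho_t^c(x)=tx+cx^q$; that is, $N\mapsto\rho^c_N(x)$ is the $\mathbb F_q$-algebra homomorphism from $\mathbb F_q[t]$ to the ring of $\mathbb F_q$-linear polynomials over $K$ (under addition and composition) sending $t$ to $\rho_t^c$. For nonconstant $N\in\mathbb F_q[t]$, the roots of $\rho^c_N(x)$ in $K^{\mathrm{sep}}$ form a free $\mathbb F_q[t]/(N)$-module of rank one, giving a representation $\operatorname{Gal}(K^{\mathrm{sep}}/K)\to(\mathbb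 F_q[t]/(N))^\times$. The adelic Galois representation is the inverse limit over all $N$, $\operatorname{Gal}(K^{\mathrm{sep}}/K)\to\varprojlim_N(\mathbb F_q[t]/(N))^\times$. *)

(* Defs.v *)
From HB Require Import structures.
From mathcomp Require Import all_boot all_order all_algebra.
From mathcomp Require Import all_fingroup all_solvable all_field.

Set Implicit Arguments.
Unset Strict Implicit.
Unset Printing Implicit Defensive.

Import GRing.Theory.
Local Open Scope ring_scope.

(** * Iterated wreath products of cyclic groups *)

Section PermuteFactors.

Local Open Scope group_scope.

Variables (S : finType) (G A : finGroupType) (to : {action G &-> S}).

(* MathComp actions are right actions, whence the inverse: the factor at [s]
   is moved to the factor at [to s g]. *)
Definition permute_fun (f : {dffun forall s : S, A}) (g : G) :
    {dffun forall s : S, A} :=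
  [ffun s => f (to s g^-1)].

Lemma permute_fun1 : permute_fun^~ 1 =1 id.
Proof. by move=> f; apply/ffunP=> s; rewrite ffunE invg1 act1. Qed.

Lemma permute_funM f : act_morph permute_fun f.
Proof. by move=> g h; apply/ffunP=> s; rewrite !ffunE invMg actM. Qed.

Definition permute_action : {action G &-> {dffun forall s : S, A}} :=
  TotalAction permute_fun1 permute_funM.

Lemma permute_is_groupAction :
  is_groupAction [set: {dffun forall s : S, A}] permute_action.
Proof.
move=> g _; rewrite inE; apply/andP; split.
  by apply/subsetP=> f _; rewrite inE.
by apply/morphicP=> f h _ _; rewrite !permE; apply/ffunP=> s; rewrite !ffunE.
Qed.

Definition permute_groupAction :
    groupAction [set: G] [set: {dffun forall s : S, A}] :=
  GroupAction permute_is_groupAction.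

Definition wreath : finGroupType := sdprod_by permute_groupAction.

(* An element [(g, f)] of the semidirect product moves the vertex [s] to
   [to s g], and its children by the component of [f] at [to s g]. *)
Definition wreath_fun (v : S * A) (w : wreath) : S * A :=
  let: (g, f) := pair_of_sd w in (to v.1 g, v.2 * f (to v.1 g)).

Lemma wreath_fun1 : wreath_fun^~ 1 =1 id.
Proof. by case=> s i; rewrite /wreath_fun /= act1 ffunE mulg1. Qed.

Lemma wreath_funM v : act_morph wreath_fun v.
Proof.
case: v => s i [[g f] gf] [[h k] hk] /=.
by rewrite /wreath_fun /= actM !ffunE actK mulgA.
Qed.

Definition wreath_action : {action wreath &-> S * A} :=
  TotalAction wreath_fun1 wreath_funM.

End PermuteFactors.

Record level_group := LevelGroup {
  level : finType;
  level_grp : finGroupType;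
  level_act : {action level_grp &-> level} }.

(* [cyclic_tower d n] is the group [W_(n+1)] together with its action on the
   [d ^ (n+1)] vertices at level [n+1] of the rooted [d]-ary tree. It is
   meaningful for [1 < d], as ['Z_d] has order 2 for [d < 2]. *)
Fixpoint cyclic_tower (d n : nat) : level_group :=
  if n is m.+1 then
    LevelGroup (wreath_action ('Z_d) (level_act (cyclic_tower d m)))
  else LevelGroup ('R : {action 'Z_d &-> 'Z_d}).

Definition iter_wreath (d n : nat) : finGroupType :=
  level_grp (cyclic_tower d n.-1).

(** * Arboreal Galois groups *)

Definition iter_comp (K : fieldType) (n : nat) (f : {poly K}) : {poly K} :=
  iter n (fun p => f \Po p) 'X.

Definition is_splitting_field (K : fieldType) (f : {poly K})
    (L : splittingFieldType K) : Prop :=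
  splittingFieldFor 1%AS (map_poly (in_alg L) f) {:L}.

Definition arboreal_maximal (K : fieldType) (d : nat) (f : {poly K}) : Prop :=
  forall n : nat, (0 < n)%N ->
  forall L : splittingFieldType K, is_splitting_field (iter_comp n f) L ->
  'Gal({:L} / 1%AS) \isog [set: iter_wreath d n].

(** * Adelic Galois representations of rank-one Drinfeld modules *)

Definition separable_closure (K Ks : fieldType) (iota : {rmorphism K -> Ks}) :
    Prop :=
  (forall x : Ks, exists2 p : {poly K},
     separable_poly p & root (map_poly iota p) x) /\
  (forall p : {poly Ks}, separable_poly p -> (1 < size p)%N ->
     exists x, root p x).

Section Drinfeld.

Variable F : finFieldType.

Local Notation K := {fraction {poly F}}.

Definition ratvar : K := tofrac 'X.

(* [t x + c x ^ q] with [q] the number of elements of [F] *)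
Definition carlitz_t (c : K) : {poly K} := ratvar *: 'X + c *: 'X^#|F|.

Definition carlitz (c : K) (N : {poly F}) : {poly K} :=
  \sum_(i < size N) tofrac (N`_i)%:P *: iter_comp i (carlitz_t c).

(* Every ideal [(N)] of [F[t]] with [N] nonconstant has exactly one monic
   generator, and [{poly %/ N}] is [F[t]/(N)] only for such [N]. *)
Definition modulus (N : {poly F}) : bool := (1 < size N)%N && (N \is monic).

(* The families [a] in the inverse limit of the groups [(F[t]/(N))^*]; the
   values of [a] at polynomials that are not moduli are irrelevant. *)
Definition adelic_unit (a : forall N : {poly F}, {poly %/ N}) : Prop :=
  (forall N, modulus N -> a N \is a GRing.unit) /\
  (forall M N, modulus M -> modulus N -> M %| N ->
     in_qpoly M (a N : {poly F}) = a M).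

Section Representation.

Variables (c : K) (Ks : fieldType) (iota : {rmorphism K -> Ks}).

Definition galois_aut (sigma : {rmorphism Ks -> Ks}) : Prop :=
  bijective sigma /\ forall x : K, sigma (iota x) = iota x.

(* [a] is the image of [sigma]: for every [N], [sigma] acts on the roots of
   [carlitz c N] as the scalar [a N]. *)
Definition adelic_image (sigma : {rmorphism Ks -> Ks})
    (a : forall N : {poly F}, {poly %/ N}) : Prop :=
  forall N, modulus N -> forall x : Ks,
    root (map_poly iota (carlitz c N)) x ->
    sigma x = (map_poly iota (carlitz c (a N : {poly F}))).[x].

Definition adelic_surjective : Prop :=
  forall a, adelic_unit a ->
  exists2 sigma, galois_aut sigma & adelic_image sigma a.

End Representation.

End Drinfeld.

(* Main.v *)
(** Put [u = t + 1] and [a = t / u]. Substituting [x = u y] turns [f_c] into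
    [g(y) = y ^ 6 + a], and [K = F_7(a)].

    Arboreal part. Let [P_n = g^n(0)], a polynomial in [a]. In characteristic 7
    one has [P_(n-1) P_n' = (a P_(n-1))' - P_n P_(n-1)'], so the repeated factors
    of [P_n] divide a polynomial of degree at most [6 ^ (n-2)]; comparing degrees,
    [P_n] has a simple irreducible factor [r] dividing no earlier [P_m]. Above
    such an [r], two distinct roots of [g^n] can only be congruent when they have
    the same parent and lie in the chosen prime, and looking at the product of all
    roots, the inertia group has to act on the six children of one single vertex
    as the full group of sixth roots of unity, fixing the rest of level [n]. By
    transitivity on level [n-1] and conjugation these elements generate the kernel
    of [W_n -> W_(n-1)], whence maximality by induction. Ramification is handled
    without valuations: in the integral closure of [F_7[a]], an element of the
    inertia field lying in a prime above [r] is a multiple of [r] up to a factor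
    outside that prime, by a trace argument.

    Adelic part. The [(t + 1)]-torsion consists of the [u y] with [y = 0] or
    [y ^ 6 = -1], and contains [u i] with [i ^ 2 = -1]. An automorphism acting by
    the scalar 3 would send [i] to [3 i], although [3 ^ 2 <> 1] in [F_7]. *)

Require Import Defs.
From mathcomp Require Import all_boot all_order all_algebra all_field.
From mathcomp Require Import all_fingroup all_solvable ring zify.
From mathcomp Require boolp classical_sets.

Set Implicit Arguments.
Unset Strict Implicit.
Unset Printing Implicit Defensive.

Import GRing.Theory.
Local Open Scope ring_scope.

(** * The critical orbit *)

Section PolynomialFactors.
Variable F : fieldType.
Implicit Types p q r : {poly F}.

Lemma irreducible_factor p :
  (1 < size p)%N -> exists2 r, irreducible_poly r & r %| p.
Proof.
have [n] := ubnP (size p); elim: n p => // n IHn p le_p p_gt1.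
case: (boolp.EM (exists2 d : {poly F}, (1 < size d < size p)%N & d %| p)).
  case=> d /andP[d1 dp] d_p; have [|//|r irr rd] := IHn d; first by lia.
  by exists r; rewrite ?(dvdp_trans rd).
move=> noD; exists p => //; split=> // d d1 d_p; rewrite -dvdp_size_eqp // eqn_leq.
have p0 : p != 0 by rewrite -size_poly_gt0; lia.
rewrite dvdp_leq //= leqNgt; apply/negP => dp; apply: noD; exists d => //.
have := dvdpN0 d_p p0; rewrite -size_poly_gt0 dp andbT => d0.
by rewrite ltn_neqAle eq_sym d1.
Qed.

Lemma exact_power r p : (1 < size r)%N -> p != 0 ->
  exists k, (r ^+ k %| p) && ~~ (r ^+ k.+1 %| p).
Proof.
move=> r1 p0; have ex0 : exists k, r ^+ k %| p by exists 0; rewrite expr0 dvd1p.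
have bnd k : r ^+ k %| p -> (k <= size p)%N.
  move/(dvdp_leq p0); have : (k <= (size r).-1 * k)%N.
    by rewrite leq_pmull // -ltnS prednK // ltnW.
  rewrite -size_exp; by move=> h1 h2; apply: leq_trans h1 (leq_trans (leq_pred _) h2).
case: (ex_maxnP ex0 bnd) => k rk maxk; exists k; rewrite rk /=.
by apply/negP => /maxk; rewrite ltnn.
Qed.

(** Take an irreducible factor [r] of [p / gcdp p q], which is not constant. Its multiplicity in [p]
    exceeds that in the gcd, hence that in [q]. *)
Lemma prime_power_witness p q : p != 0 -> ~~ (p %| q) ->
  exists r k, [/\ irreducible_poly r, r ^+ k %| p & ~~ (r ^+ k %| q)].
Proof.
move=> p0 npq; set g := gcdp p q.
have g0 : g != 0 by rewrite gcdp_eq0 negb_and p0.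
have [p1 Dp] := dvdpP _ _ (dvdp_gcdl p q).
have p1_gt1 : (1 < size p1)%N.
  rewrite ltnNge; apply: contra npq => le1.
  have /size_poly1P[c c0 Dp1] : size p1 == 1%N.
    rewrite eqn_leq le1 size_poly_gt0; apply: contraNneq p0 => p10.
    by rewrite Dp p10 mul0r.
  by rewrite Dp Dp1 mul_polyC dvdpZl // dvdp_gcdr.
have [r irr r_p1] := irreducible_factor p1_gt1.
have [k /andP[rk nrk]] := exact_power irr.1 g0.
have rp : r ^+ k.+1 %| p by rewrite Dp exprS dvdp_mul.
exists r, k.+1; split=> //; apply: contra nrk => rq.
by rewrite dvdp_gcd rp.
Qed.

Lemma dvdp_exp_deriv r p k : r ^+ k.+1 %| p -> r ^+ k %| p^`().
Proof.
case/dvdpP=> s ->; rewrite derivM deriv_exp dvdp_add //.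
  by rewrite dvdp_mull // dvdp_exp2l.
by rewrite dvdp_mull // -mulr_natl mulrA dvdp_mulIr.
Qed.

End PolynomialFactors.

(** * Rigid divisibility and primitive factors of the critical orbit *)

Section CriticalOrbit.

Local Notation F := 'F_7.

(* [crit n] is [g^n(0)] for [g(y) = y ^ 6 + 'X]. *)
Fixpoint crit (n : nat) : {poly F} := if n is m.+1 then crit m ^+ 6 + 'X else 0.

Lemma size_crit n : size (crit n.+1) = (6 ^ n).+1.
Proof.
elim: n => [|n IHn]; first by rewrite /= expr0n add0r size_polyX.
have s6 : size (crit n.+1 ^+ 6) = (6 ^ n.+1).+1.
  have := size_exp (crit n.+1) 6; rewrite IHn /= -expnSr => <-.
  by rewrite prednK // size_poly_gt0 expf_neq0 // -size_poly_gt0 IHn.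
rewrite [crit _]/= size_polyDl -/(crit n.+1) s6 // size_polyX.
by have := expn_gt0 6 n; rewrite expnS; lia.
Qed.

Lemma crit_neq0 n : crit n.+1 != 0.
Proof. by rewrite -size_poly_gt0 size_crit. Qed.

Lemma crit_coef0 n : (crit n)`_0 = 0.
Proof.
elim: n => [|n IHn]; first by rewrite coef0.
by rewrite /= coefD coefX exprS coef0M IHn mul0r addr0.
Qed.

Lemma crit_coef1 n : (crit n.+1)`_1 = 1.
Proof.
rewrite /= coefD coefX !exprS mulrA coefM !big_ord_recl big_ord0 /=.
by rewrite !coef0M coefM !big_ord_recl big_ord0 /= !crit_coef0; ring.
Qed.

(** The orbits of [crit m] and of 0 agree modulo [crit m ^+ 6] after one step, and congruence is
    preserved by every further step. *)
Lemma crit_shift m j : crit m ^+ 6 %| crit (m + j.+1) - crit j.+1.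
Proof.
elim: j => [|j IHj]; first by rewrite addn1 /= expr0n add0r addrK.
have -> : crit (m + j.+2) - crit j.+2 = crit (m + j.+1) ^+ 6 - crit j.+1 ^+ 6.
  by rewrite addnS; cbn [crit]; rewrite opprD addrACA subrr addr0.
by rewrite subrXX dvdp_mulr.
Qed.

(** Rigid divisibility: the power of [r] found at its first appearance [crit i] cannot grow later.
    If [r ^+ e] is the first power missing from [crit i], then [e] is at least 2, so [r ^+ e]
    divides [crit i ^+ 6] and the orbit has period [i] modulo [r ^+ e]. *)
Lemma crit_rigid r m n k :
    (0 < m)%N -> (0 < k)%N -> (0 < n)%N ->
    r %| crit m -> r ^+ k %| crit n ->
  exists2 i, (0 < i <= m)%N & r ^+ k %| crit i.
Proof.
move=> m0 k0 n0 rm rkn.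
have ex0 : exists i, (0 < i)%N && (r %| crit i) by exists m; rewrite m0.
case: (ex_minnP ex0) => i /andP[i0 ri] mini.
exists i; first by rewrite i0 mini ?m0.
case: (boolP (r ^+ k %| crit i)) => // nrk.
have ex1 : exists j, ~~ (r ^+ j %| crit i) by exists k.
case: (ex_minnP ex1) => e nre mine.
have e2 : (1 < e)%N by case: (e) nre => [|[|?]]; rewrite ?expr1 ?expr0 ?dvd1p ?ri.
have le_ek : (e <= k)%N by apply: mine.
have re6 : r ^+ e %| crit i ^+ 6.
  have : r ^+ e.-1 %| crit i.
    by apply: contraT => /mine; lia.
  move/(dvdp_exp2r 6); rewrite -exprM; apply: dvdp_trans.
  by rewrite dvdp_exp2l //; lia.
(* Before [i] not even [r] divides; beyond [i], descend from [j] to [j - i] by [crit_shift]. *)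
have H j : (0 < j)%N -> ~~ (r ^+ e %| crit j).
  have [l] := ubnP j; elim: l j => // l IHl j le_j j0.
  case: (ltngtP j i) => [lt_ji|lt_ij|-> //].
    apply/negP => rej; have := mini j; rewrite j0 (dvdp_trans _ rej); first by lia.
    by rewrite -{1}[r]expr1 dvdp_exp2l //; lia.
  have Dj : j = (i + (j - i).-1.+1)%N by lia.
  have := crit_shift i (j - i).-1; rewrite -Dj => /(dvdp_trans re6) d.
  apply/negP => rej; have : r ^+ e %| crit (j - i).-1.+1.
    by rewrite -(dvdp_addr _ d) subrK.
  by apply/negP; apply: IHl; lia.
by case/negP: (H n n0); apply: dvdp_trans rkn; apply: dvdp_exp2l.
Qed.

(* In characteristic 7, [P_(n+1)' = 1 - P_n ^ 5 P_n']; multiplying by [P_n] and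
   using [P_n ^ 6 = P_(n+1) - X] gives this identity, so repeated factors of
   [P_(n+1)] divide [(X P_n)'], whose degree is much smaller. *)
Lemma crit_deriv n :
  ('X * crit n)^`() = crit n * (crit n.+1)^`() + crit n.+1 * (crit n)^`().
Proof.
have c7 : 6%:R = -1 :> {poly F}.
  by rewrite -(rmorph_nat (@polyC F)) -polyCN; congr (_%:P); apply/eqP.
rewrite [crit n.+1]/= derivM derivD deriv_exp derivX -mulr_natr c7.
by rewrite exprS; ring.
Qed.

(** Let [T] be the product of the earlier terms. By degrees the new term does not divide
    [T * W ^+ 2], so some [r ^+ k] divides the term but not this product. Rigidity would put
    [r ^+ k] into [T] if [r] had occurred before. Since [r ^+ k.-1] divides [W], having [k] at least
    2 would put [r ^+ k] into [W ^+ 2]. *)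
Lemma crit_primitive_factor n : (0 < n)%N ->
  exists r w, [/\ irreducible_poly r, crit n = r * w, ~~ (r %| w) &
    forall m, (0 < m < n)%N -> ~~ (r %| crit m)].
Proof.
case: n => // [[|n]] _.
  exists 'X, 1; split; last by case.
  - by have := irredp_XsubC (0 : F); rewrite subr0.
  - by rewrite /= expr0n add0r mulr1.
  - by rewrite dvdp1 size_polyX.
set T := \prod_(i < n.+1) crit i.+1; set W := ('X * crit n.+1)^`().
have T0 : T != 0 by apply/prodf_neq0 => i _; apply: crit_neq0.
(* The linear coefficient of [W] is 2, nonzero modulo 7. *)
have W0 : W != 0.
  apply: contraTneq isT => /(congr1 (fun p : {poly F} => p`_1)).
  by rewrite /W coef_deriv coefXM crit_coef1 coef0 => /eqP.
(* The degree of [T] is the geometric sum [1 + 6 + ... + 6 ^ n]. *)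
have sT : ((size T).-1 * 5 < 6 ^ n.+1)%N.
  rewrite /T; elim: (n) => [|m IHm].
    by rewrite big_ord1 (size_crit 0).
  rewrite big_ord_recr /= -/(crit m.+2) size_mul ?crit_neq0 //; last first.
    by apply/prodf_neq0 => i _; apply: crit_neq0.
  rewrite size_crit; move: IHm; rewrite (expnS 6 m.+1).
  by move: (size _) (6 ^ m.+1)%N => x y; lia.
have sW : (size W <= (6 ^ n).+1)%N.
  have := lt_size_deriv (p := 'X * crit n.+1).
  rewrite mulf_neq0 ?polyX_eq0 ?crit_neq0 // size_mul ?polyX_eq0 ?crit_neq0 //.
  by rewrite size_polyX size_crit => /(_ isT).
have nd : ~~ (crit n.+2 %| T * W ^+ 2).
  apply/negP => /dvdp_leq; rewrite mulf_neq0 ?expf_neq0 // => /(_ isT).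
  rewrite size_mul ?expf_neq0 // size_crit.
  have := size_exp W 2; have := size_poly_gt0 T; rewrite T0.
  move: sT sW; rewrite !expnS.
  by move: (size T) (size W) (size (W ^+ 2)) (6 ^ n)%N => x y z e; lia.
have [r [k [irr rk nrk]]] := prime_power_witness (crit_neq0 _) nd.
have k0 : (0 < k)%N by case: (k) nrk => //; rewrite expr0 dvd1p.
have prim m : (0 < m < n.+2)%N -> ~~ (r %| crit m).
  case/andP=> m0 mn; apply: contra nrk => rm.
  have [i /andP[i0 im] ri] := crit_rigid m0 k0 (isT : (0 < n.+2)%N) rm rk.
  rewrite dvdp_mulr // (dvdp_trans ri) //.
  have lt_i : (i.-1 < n.+1)%N by lia.
  by rewrite /T (bigD1 (Ordinal lt_i)) //= -/(crit i.-1.+1) prednK // dvdp_mulIl.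
have rW j : r ^+ j.+1 %| crit n.+2 -> r ^+ j %| W.
  move=> rj; rewrite /W crit_deriv; apply: dvdp_add.
    by apply: dvdp_mull; apply: dvdp_exp_deriv.
  by apply: dvdp_mulr; apply: dvdp_trans rj; apply: dvdp_exp2l.
have k1 : k = 1.
  apply/eqP; rewrite eqn_leq k0 andbT leqNgt; apply: contra nrk => k1.
  rewrite dvdp_mull //; have /(dvdp_exp2r 2) : r ^+ k.-1 %| W.
    by apply: rW; rewrite prednK.
  by rewrite -exprM; apply: dvdp_trans; rewrite dvdp_exp2l //; lia.
move: rk nrk; rewrite k1 expr1 => /dvdpP[w Dw] nr.
exists r, w; split=> //; first by rewrite mulrC.
apply: contra nr => rw; rewrite dvdp_mull // dvdp_mull //.
by rewrite -[r]expr1 rW // Dw expr2 dvdp_mul.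
Qed.

End CriticalOrbit.

(** * Inertia in the integral closure of [F[X]] *)

Section Ramification.

Variables (F K : fieldType) (iota : {rmorphism {poly F} -> K}).
Hypothesis iota_inj : injective iota.
Hypothesis iota_frac :
  forall z, exists p q, iota q != 0 /\ z = iota p / iota q.

Variable L : splittingFieldType K.
Hypothesis galL : galois 1 {:L}.

Local Notation G := ('Gal({:L} / 1%AS))%g.

(** The embedding [iota] is kept arbitrary because ['X] will be sent to [t / (t + 1)], not to
    [t]. *)
Definition base : {rmorphism {poly F} -> L} := GRing.in_alg L \o iota.
Definition integral (x : L) : Prop := integralOver base x.

Lemma base_inj : injective base.
Proof. exact: inj_comp (fmorph_inj _) iota_inj. Qed.

Lemma gal_fix (s : gal_of {:L}) k : s \in G -> s (k%:A) = k%:A.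
Proof. by move/fixed_gal; apply; rewrite ?sub1v // rpredZ // mem1v. Qed.

Lemma gal_base (s : gal_of {:L}) p : s \in G -> s (base p) = base p.
Proof. exact: gal_fix. Qed.

Lemma gal_fixed x : (forall s, s \in G -> s x = x) -> exists k : K, x = k%:A.
Proof.
move=> fix_x; apply/vlineP; have /galois_fixedField <- := galL.
by apply/fixedFieldP; rewrite ?memvf.
Qed.

Lemma integral_gal (s : gal_of {:L}) x : s \in G -> integral x -> integral (s x).
Proof.
move=> Gs [p mon_p /rootP px0]; exists p => //; apply/rootP.
have -> : map_poly base p = map_poly s (map_poly base p).
  by rewrite -map_poly_comp; apply: eq_map_poly => q /=; rewrite gal_base.
by rewrite horner_map px0 rmorph0.
Qed.

Lemma integral_base p : integral (base p). Proof. exact: integral_id. Qed.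

(** Rational root argument: after clearing denominators, [q] divides every term except the leading
    one, [p ^+ n]. *)
Lemma fraction_root (f : {poly {poly F}}) (p q : {poly F}) (z : K) :
  f \is monic -> (map_poly iota f).[z] = 0 -> z * iota q = iota p ->
  q %| p ^+ (size f).-1.
Proof.
move=> mon_f fz Dz; case Dn: (size f) => [|n].
  by move: mon_f; rewrite monicE lead_coefE Dn /= nth_default ?Dn // eq_sym oner_eq0.
have lf : f`_n = 1 by have /eqP := mon_f; rewrite lead_coefE Dn.
suff Dp : p ^+ n = - \sum_(i < n) f`_i * p ^+ i * q ^+ (n - i).
  rewrite /= Dp dvdpNr; elim/big_ind: _ => [|x y|i _]; rewrite ?dvdp0 //.
    exact: dvdp_add.
  by rewrite -(subnSK (ltn_ord i)) exprS mulrCA dvdp_mulIl.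
apply: iota_inj; apply/eqP; rewrite rmorphN -addr_eq0 rmorph_sum /=.
move: fz; rewrite horner_coef size_map_poly_id0; last first.
  by rewrite (eqP mon_f) rmorph1 oner_eq0.
rewrite Dn big_ord_recr /= [X in _ + X * _]coef_map.
rewrite [X in _ + X * _](etrans (congr1 iota lf) (rmorph1 iota)) mul1r.
move/(congr1 (fun w => w * iota q ^+ n)).
rewrite mul0r mulrDl -exprMn Dz mulr_suml => E; rewrite -[X in _ == X]E.
rewrite addrC rmorphXn; apply/eqP; congr (_ + _); apply: eq_bigr => i _.
rewrite coef_map !rmorphM !rmorphXn /= -Dz exprMn -!mulrA; congr (_ * (_ * _)).
by rewrite -exprD subnKC // ltnW.
Qed.

(** Integral closedness of [F[X]]: in lowest terms the denominator divides a power of the numerator,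
    so it is constant. *)
Lemma integral_algE k : integral (k%:A) -> exists p, k = iota p.
Proof.
case=> f mon_f; rewrite /root map_poly_comp horner_map fmorph_eq0 => /eqP fk0.
have [p [q [q0 Dk]]] := iota_frac k.
have q0' : q != 0 by apply: contraNneq q0 => ->; rewrite rmorph0.
set g := gcdp p q; set p1 := p %/ g; set q1 := q %/ g.
have g0 : g != 0 by rewrite gcdp_eq0 negb_and q0' orbT.
have cop : coprimep q1 p1.
  by rewrite coprimep_sym coprimep_div_gcd // q0' orbT.
have ig0 : iota g != 0 by rewrite -(rmorph0 iota) (inj_eq iota_inj).
have [Dp Dq] : p = p1 * g /\ q = q1 * g by rewrite !divpK ?dvdp_gcdl ?dvdp_gcdr.
have Dk1 : k * iota q1 = iota p1.
  by apply: (mulIf ig0); rewrite -mulrA -!rmorphM /= -Dp -Dq Dk mulfVK.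
have := fraction_root mon_f fk0 Dk1.
have := coprimep_expr (size f).-1 cop => copX.
rewrite -[X in _ %| X]mulr1 Gauss_dvdpr // dvdp1 => /size_poly1P[c c0 Dc].
exists (c^-1 *: p1); apply: (mulIf (x := iota q1)).
  by rewrite -(rmorph0 iota) (inj_eq iota_inj) Dc polyC_eq0.
by rewrite Dk1 -rmorphM Dc mulrC mul_polyC scalerA divff ?scale1r.
Qed.

(** A prime ideal of the integral closure, as a predicate on [L]. The field [prime_base] places it
    above [r], and for irreducible [r] also makes it proper. *)
Record prime_over (r : {poly F}) (m : L -> Prop) : Prop := PrimeOver {
  prime_integral : forall x, m x -> integral x;
  prime_add : forall x y, m x -> m y -> m (x + y);
  prime_mul : forall x y, integral y -> m x -> m (y * x);
  primeM : forall x y, integral x -> integral y -> m (x * y) -> m x \/ m y;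
  prime_base : forall p, m (base p) <-> r %| p }.

Lemma prime_over_exists r : irreducible_poly r -> exists m, prime_over r m.
Proof.
move=> irr.
pose ideal (m : L -> Prop) := [/\ forall x, m x -> integral x,
  forall x y, m x -> m y -> m (x + y), forall x y, integral y -> m x -> m (y * x),
  m (base r) & ~ m 1].
have ir0 : iota r != 0 by rewrite -(rmorph0 iota) (inj_eq iota_inj) irredp_neq0.
have br0 : base r != 0 by rewrite -(rmorph0 base) (inj_eq base_inj) irredp_neq0.
pose P m := m = classical_sets.set0 \/ ideal m.
have chain (C : (L -> Prop) -> Prop) : (forall m, C m -> P m) ->
    classical_sets.total_on C classical_sets.subset ->
  P (classical_sets.bigcup C id).
  move=> CP Ctot; case: (boolp.EM (exists2 m, C m & ideal m)) => [[m Cm Im]|noI].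
    right; have Ci n x : C n -> n x -> ideal n.
      by move=> Cn nx; case: (CP n Cn) => // n0; rewrite n0 in nx.
    split.
    - by move=> x [n Cn nx]; have [nI _ _ _ _] := Ci n x Cn nx; apply: nI.
    - move=> x y [n Cn nx] [n' Cn' ny].
      have [_ nD _ _ _] := Ci n x Cn nx; have [_ nD' _ _ _] := Ci n' y Cn' ny.
      by case: (Ctot n n' Cn Cn') => sub; [exists n' | exists n]; rewrite //=;
        [apply: nD' | apply: nD] => //; apply: sub.
    - move=> x y Iy [n Cn nx]; have [_ _ nM _ _] := Ci n x Cn nx.
      by exists n => //; apply: nM.
    - by exists m => //; have [] := Im.
    by case=> n Cn n1; have [_ _ _ _ /(_ n1)] := Ci n 1 Cn n1.
  left; apply: boolp.funext => x; apply: boolp.propext; split=> // -[n Cn nx].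
  by case: (CP n Cn) => [n0|In]; [rewrite n0 in nx | case: noI; exists n].
have [m [Pm maxm]] := classical_sets.Zorn_bigcup chain.
  (* The ideal generated by [r] is proper because [1 / r] is not integral. It also rules out the
     empty predicate as a maximal element. *)
  have idr : ideal (fun x => exists2 y, integral y & x = y * base r).
    split=> [_ [y Iy ->]|_ _ [y Iy ->] [z Iz ->]|_ z Iz [y Iy ->]||[y Iy D1]].
    - exact/integral_mul/integral_base.
    - by exists (y + z); rewrite ?mulrDl //; apply: integral_add.
    - by exists (z * y); rewrite ?mulrA //; apply: integral_mul.
    - by exists 1; rewrite ?mul1r //; apply: integral1.
    have Dy : y = (iota r)^-1%:A.
      by apply: (mulIf br0); rewrite -D1 /base /= mulr_algl scalerA mulVf // scale1r.
    have [p Dp] : exists p, (iota r)^-1 = iota p by apply: integral_algE; rewrite -Dy.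
    have /eqP : iota (r * p) = iota 1.
      by rewrite rmorphM -Dp rmorph1 mulfV.
    rewrite (inj_eq iota_inj) => /eqP D; have : r %| 1 by rewrite -D dvdp_mulIl.
    by rewrite dvdp1; case: irr => r1 _; rewrite gtn_eqF.
  case: Pm => [m0|[mI mD mM mr m1]].
    case: (maxm _ _ (or_intror idr)); rewrite m0; split; first by move=> x [].
    by move/(_ (base r)) => []; exists 1; rewrite ?mul1r //; apply: integral1.
  exists m; split=> //.
    move=> x y Ix Iy mxy; case: (boolp.EM (m x)) => [|nmx]; [by left | right].
    (* If [x] is not in [m], maximality forces [m + (x)] to contain 1; multiplying by [y] then gives
       [y] in [m]. *)
    pose m' z := exists u v, [/\ m u, integral v & z = u + v * x].
    have m0 : m 0 by rewrite -(mul0r (base r)); apply: mM; first exact: integral0.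
    have m'1 : m' 1.
      apply: boolp.contrapT => m'1; case: (maxm m'); last first.
        right; split=> //.
        - move=> _ [u [v [mu Iv ->]]]; apply: integral_add; first exact: mI.
          exact: integral_mul.
        - move=> _ _ [u [v [mu Iv ->]]] [u' [v' [mu' Iv' ->]]].
          exists (u + u'), (v + v'); split; [exact: mD | exact: integral_add |].
          by rewrite mulrDl addrACA.
        - move=> _ z Iz [u [v [mu Iv ->]]].
          exists (z * u), (z * v); split; [exact: mM | exact: integral_mul |].
          by rewrite mulrDr mulrA.
        by exists (base r), 0; split; rewrite ?mul0r ?addr0 //; apply: integral0.
      split=> [z mz|sub].
        by exists z, 0; split; rewrite ?mul0r ?addr0 //; apply: integral0.
      apply: nmx; apply: sub; exists 0, 1; split=> //; first exact: integral1.
      by rewrite mul1r add0r.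
    case: m'1 => u [v [mu Iv D1]].
    rewrite -[y]mul1r D1 mulrDl mulrC; apply: mD; first exact: mM.
    by rewrite -mulrA; apply: mM.
  move=> p; split=> [mp|/dvdpP[q ->]]; last first.
    by rewrite rmorphM; apply: mM => //; apply: integral_base.
  apply: contraT => nrp; case: m1.
  have := irreducible_poly_coprime p irr; rewrite nrp => /Bezout_eq1_coprimepP.
  case=> -[u v] /= D1; rewrite -(rmorph1 base) -D1 rmorphD !rmorphM.
  by apply: mD; apply: mM => //; apply: integral_base.
Qed.

(** * Decomposition and inertia at a prime *)

Section Inertia.

Variables (r : {poly F}) (m : L -> Prop).
Hypotheses (irr : irreducible_poly r) (Pm : prime_over r m).

Local Notation mI := (prime_integral Pm).
Local Notation mD := (prime_add Pm).
Local Notation mM := (prime_mul Pm).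

Lemma prime0 : m 0.
Proof. by rewrite -(rmorph0 base) (prime_base Pm) dvdp0. Qed.

Lemma primeN x : m x -> m (- x).
Proof. by rewrite -mulN1r; apply: mM; apply/integral_opp/integral1. Qed.

Lemma primeB x y : m x -> m y -> m (x - y).
Proof. by move=> mx /primeN; apply: mD. Qed.

Lemma prime_const (c : F) : c != 0 -> ~ m (base c%:P).
Proof.
move=> c0 /(prime_base Pm); rewrite -[c]mulr1 -scale_polyC.
by rewrite dvdpZr // dvdp1 (gtn_eqF irr.1).
Qed.

Lemma prime1 : ~ m 1.
Proof. by rewrite -(rmorph1 base); apply: prime_const; apply: oner_neq0. Qed.

Lemma prime_congM a a' b b' : integral b -> integral a' ->
  m (a - a') -> m (b - b') -> m (a * b - a' * b').
Proof.
move=> Ib Ia' ma mb; have -> : a * b - a' * b' = b * (a - a') + a' * (b - b') by ring.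
by apply: mD; apply: mM.
Qed.

Lemma prime_congX a b n : integral a -> integral b -> m (a - b) -> m (a ^+ n - b ^+ n).
Proof.
move=> Ia Ib mab; elim: n => [|n IHn]; first by rewrite subrr; apply: prime0.
rewrite !exprS; apply: prime_congM => //.
by elim: (n) => [|k IHk]; [apply: integral1 | rewrite exprS; apply: integral_mul].
Qed.

Lemma integral_prod (I : Type) (s : seq I) (P : pred I) f :
  (forall i, P i -> integral (f i)) -> integral (\prod_(i <- s | P i) f i).
Proof.
by move=> If; elim/big_ind: _ => //; [apply: integral1 | move=> *; apply: integral_mul].
Qed.

Lemma integral_sum (I : Type) (s : seq I) (P : pred I) f :
  (forall i, P i -> integral (f i)) -> integral (\sum_(i <- s | P i) f i).
Proof.
by move=> If; elim/big_ind: _ => //; [apply: integral0 | move=> *; apply: integral_add].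
Qed.

Lemma prime_prodN (I : Type) (s : seq I) (P : pred I) f :
  (forall i, P i -> integral (f i) /\ ~ m (f i)) -> ~ m (\prod_(i <- s | P i) f i).
Proof.
move=> Hf; suff [] : integral (\prod_(i <- s | P i) f i) /\ ~ m (\prod_(i <- s | P i) f i) by [].
elim/big_ind: _ => //; first by split; [apply: integral1 | apply: prime1].
move=> x y [Ix mx] [Iy my]; split; first exact: integral_mul.
by case/(primeM Pm Ix Iy).
Qed.

(** If no such [e] exists, then [s^-1] maps [m] into itself, and so does [s], being a power of
    [s^-1] by finiteness. *)
Lemma prime_stabilizer (s : gal_of {:L}) : s \in G ->
  (forall x, m x -> m (s x)) \/ exists e, [/\ integral e, ~ m e & m (s e)].
Proof.
move=> Gs; case: (boolp.EM (exists e, [/\ integral e, ~ m e & m (s e)])) => [|noe].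
  by right.
left=> x mx; have Vm y : m y -> m ((s^-1)%g y).
  move=> my; apply: boolp.contrapT => nmy; apply: noe; exists ((s^-1)%g y).
  split=> //; first by apply: integral_gal; rewrite ?groupV //; apply: mI.
  by rewrite -galM ?memvf // mulVg gal_id.
have -> : s = ((s^-1) ^+ #[(s^-1)%g].-1)%g by rewrite -invg_expg invgK.
elim: (_.-1) => [|k IHk]; first by rewrite expg0 gal_id.
by rewrite expgSr galM ?memvf //; apply: Vm.
Qed.

(** Multiply the elements [e] supplied by [prime_stabilizer] for the automorphisms that do not
    preserve [m]. *)
Lemma prime_separator : exists e, [/\ integral e, ~ m e &
  forall s, s \in G -> (forall x, m x -> m (s x)) \/ m (s e)].
Proof.
suff [e [Ie me He]] : exists e, [/\ integral e, ~ m e &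
    forall s, s \in enum G -> (forall x, m x -> m (s x)) \/ m (s e)].
  by exists e; split=> // s Gs; apply: He; rewrite mem_enum.
have : {subset enum G <= G} by move=> s; rewrite mem_enum.
elim: (enum _) => [|s l IHl] sub.
  by exists 1; split=> //; [apply: integral1 | apply: prime1].
have [|e [Ie me He]] := IHl; first by move=> t lt; apply: sub; rewrite inE lt orbT.
have Gs : s \in G by apply: sub; rewrite mem_head.
case: (prime_stabilizer Gs) => [ms|[e' [Ie' me' mse']]].
  by exists e; split=> // t; rewrite inE => /predU1P[->|/He //]; left.
exists (e * e'); split; first exact: integral_mul.
  by case/(primeM Pm Ie Ie').
move=> t; rewrite inE => /predU1P[->|lt]; rewrite rmorphM.
  by right; apply: mM => //; apply: integral_gal.
case: (He t lt) => [|mte]; [by left | right]; rewrite mulrC; apply: mM => //.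
by apply: integral_gal => //; apply: sub; rewrite inE lt orbT.
Qed.

Definition inertia : {set gal_of {:L}} :=
  [set s in G | boolp.asbool (forall x, integral x -> m (s x - x))].

Lemma inertiaP s :
  reflect (s \in G /\ forall x, integral x -> m (s x - x)) (s \in inertia).
Proof. by rewrite inE; apply: (iffP andP) => -[Gs /boolp.asboolP]. Qed.

Lemma inertia_group_set : group_set inertia.
Proof.
apply/group_setP; split.
  by apply/inertiaP; split=> [|x _]; rewrite ?group1 // gal_id subrr; apply: prime0.
move=> s t /inertiaP[Gs Is] /inertiaP[Gt It]; apply/inertiaP.
split=> [|x Ix]; rewrite ?groupM // galM ?memvf //.
rewrite -(subrK (s x) (t (s x))) -addrA; apply: mD; last exact: Is.
by apply: It; apply: integral_gal.
Qed.
Canonical inertia_group := Group inertia_group_set.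

(* Tame ramification index 1 over the inertia field, as divisibility by [r] in
   the local ring at [m]. *)
Lemma inertia_field_unramified z :
    m z -> (forall s, s \in inertia -> s z = z) -> #|inertia|%:R != 0 :> F ->
  exists a x, [/\ integral a, ~ m a, integral x & a * z = base r * x].
Proof.
move=> mz Iz card0; have [e [Ie me He]] := prime_separator.
(* Trace sums weighted by [h] are multiples of [r]. Starting from the plain trace, the weight is
   modified until it vanishes outside inertia. *)
pose good (h : gal_of {:L} -> L) := forall y, integral y ->
  exists2 x, integral x & \sum_(t in G) h t * t (e * y * z) = base r * x.
have good1 : good (fun=> 1).
  move=> y Iy; set w := e * y * z.
  (* Each conjugate lies in [m]: either [t] preserves [m] and [t z] is in [m], or [t e] is. The
     trace is then a polynomial divisible by [r]. *)
  have mw : m (\sum_(t in G) t w).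
    elim/big_ind: _ => [||t Gt]; [exact: prime0 | exact: mD |].
    rewrite rmorphM; case: (He t Gt) => [mt|mte].
      by apply: mM; [apply: integral_gal => //; apply: integral_mul | apply: mt].
    rewrite rmorphM -mulrA mulrC; apply: mM => //.
    by apply: integral_mul; apply: integral_gal => //; apply: mI.
  have [s Gs|k Dk] := @gal_fixed (\sum_(t in G) t w).
    rewrite rmorph_sum [RHS](reindex_inj (mulIg s)).
    by apply: eq_big => t; rewrite ?groupMr // galM ?memvf.
  have [p Dp] : exists p, k = iota p.
    by apply: integral_algE; rewrite -Dk; apply: mI.
  have mp : m (base p) by rewrite /= -Dp -Dk.
  have /dvdpP[q Dq] := proj1 (prime_base Pm p) mp.
  exists (base q); first exact: integral_base.
  rewrite (eq_bigr (fun t : gal_of {:L} => t w)) => [|t _]; last by rewrite mul1r.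
  by rewrite Dk Dp [LHS](_ : _ = base p) // Dq rmorphM mulrC.
(* The factor [t v] is absorbed by replacing [y] with [v * y]. *)
have goodM h u v : integral u -> integral v -> good h ->
    good (fun t => (u - t v) * h t).
  move=> Iu Iv gh y Iy; have [x Ix Dx] := gh y Iy.
  have [x' Ix' Dx'] := gh _ (integral_mul Iv Iy).
  exists (u * x - x'); first by apply: integral_sub => //; apply: integral_mul.
  rewrite mulrBr mulrCA -Dx -Dx' mulr_sumr -sumrB; apply: eq_bigr => t _.
  by rewrite !rmorphM /=; ring.
have /boolp.choice[y Hy] (s : gal_of {:L}) : exists y, integral y /\
    (s \in G -> s \notin inertia -> ~ m (y - s y)).
  case: (boolP (s \in inertia)) => [_|ns]; first by exists 0; split=> //; apply: integral0.
  case: (boolP (s \in G)) => [Gs|_]; last by exists 0; split=> //; apply: integral0.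
  apply: boolp.contrapT => noy; case/inertiaP: ns; split=> // x Ix.
  apply: boolp.contrapT => mx; apply: noy; exists x; split=> // _ _ /primeN.
  by rewrite opprB.
(* This factor vanishes at [t = s^-1], while at [t = 1] it lies outside [m] by the choice of [y s].
   Hence [h] vanishes off inertia, and on inertia it is congruent to [h 1], which is not in [m]. *)
pose E s t := y s - (t : gal_of {:L}) (s (y s)).
pose h t := \prod_(s in G :\: inertia) E s t.
have IE s t : s \in G -> t \in G -> integral (E s t).
  move=> Gs Gt; have [Iys _] := Hy s.
  by apply: integral_sub => //; do 2!apply: integral_gal => //.
have gh : good h.
  rewrite /h; have : {subset enum (G :\: inertia) <= G}.
    by move=> s; rewrite mem_enum => /setDP[].
  suff H l : {subset l <= G} -> good (fun t => \prod_(s <- l) E s t).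
    move/H => gl x Ix; have [w Iw Dw] := gl x Ix; exists w => //; rewrite -Dw.
    by apply: eq_bigr => t _; rewrite big_enum.
  elim: l => [|s l IHl] sub x Ix.
    have [w Iw Dw] := good1 x Ix; exists w => //; rewrite -Dw.
    by apply: eq_bigr => t _; rewrite big_nil.
  have [|||w Iw Dw] := goodM _ (y s) (s (y s)) _ _ (IHl _) x Ix.
  - by have [] := Hy s.
  - by apply: integral_gal; [apply: sub; rewrite mem_head | have [] := Hy s].
  - by move=> t lt; apply: sub; rewrite inE lt orbT.
  by exists w => //; rewrite -Dw; apply: eq_bigr => t _; rewrite big_cons.
have [x Ix Dx] := gh 1 (integral1 _).
have h0 t : t \in G -> t \notin inertia -> h t = 0.
  move=> Gt nt; have st : (t^-1)%g \in G :\: inertia.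
    by rewrite inE !groupV nt.
  by rewrite /h (bigD1 _ st) /= /E -galM ?memvf // mulVg gal_id subrr mul0r.
set c := h 1%g.
have mc : ~ m c.
  apply: prime_prodN => s /setDP[Gs ns]; split; first by apply: IE; rewrite ?group1.
  by rewrite /E gal_id; have [_] := Hy s; apply.
have Ih t : t \in G -> integral (h t).
  by move=> Gt; apply: integral_prod => s /setDP[Gs _]; apply: IE.
have hc t : t \in inertia -> m (h t - c).
  case/inertiaP=> Gt It.
  suff [] : [/\ integral (h t), integral c & m (h t - c)] by [].
  apply: (big_ind2 (fun a b => [/\ integral a, integral b & m (a - b)])).
  - by rewrite subrr; split; try exact: integral1; apply: prime0.
  - move=> a a' b b' [Ia Ia' ma] [Ib Ib' mb].
    by split; try exact: integral_mul; apply: prime_congM.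
  move=> s /setDP[Gs ns]; split; try by apply: IE; rewrite ?group1.
  rewrite /E opprB addrC addrA subrK gal_id -opprB; apply: primeN.
  by apply: It; apply: integral_gal => //; have [] := Hy s.
(* Modulo [m] this multiplier is [#|inertia| * c * e], nonzero by tameness. As inertia fixes [z], it
   factors out of the weighted trace of [e * z]. *)
exists (\sum_(t in inertia) h t * t e), x; split=> //.
- apply: integral_sum => t /inertiaP[Gt _].
  by apply: integral_mul; [apply: Ih | apply: integral_gal].
- move=> ms; have Ic : integral c by apply: Ih; apply: group1.
  have /(mD ms) : m (\sum_(t in inertia) (c * e - h t * t e)).
    elim/big_ind: _ => [||t It]; [exact: prime0 | exact: mD |].
    rewrite -opprB; apply: primeN; have [Gt It'] := inertiaP _ It.
    by apply: prime_congM => //; [apply: integral_gal | apply: hc | apply: It'].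
  rewrite -big_split /=.
  rewrite (eq_bigr (fun=> c * e)) => [|t _]; last by rewrite addrC subrK.
  rewrite sumr_const -mulr_natl => mce.
  case: (primeM Pm _ _ mce); first exact: integral_nat; first exact: integral_mul.
    by rewrite -(rmorph_nat base) -(rmorph_nat (@polyC F)); apply: prime_const.
  by case/(primeM Pm Ic Ie).
have sIG : inertia \subset G by apply/subsetP=> t /inertiaP[Gt].
rewrite -Dx mulr_suml [RHS](big_setID inertia) /= (setIidPr sIG).
rewrite [X in _ + X]big1 ?addr0 => [|t /setDP[Gt nt]]; last by rewrite h0 ?mul0r.
apply: eq_bigr => t It; rewrite mulr1 rmorphM /= mulrA; congr (_ * _).
by rewrite Iz.
Qed.

End Inertia.

End Ramification.

(** * The tree of roots *)

Section WreathActions.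

Local Open Scope group_scope.

Definition wreath_pair {S : finType} {H A : finGroupType} {to : {action H &-> S}}
    (g : H) (h : {dffun forall s : S, A}) : wreath A to :=
  SdPair (permute_groupAction A to) (introT setXP (conj (in_setT g) (in_setT h))).
Lemma wreath_pairE (S : finType) (H A : finGroupType) (to : {action H &-> S})
    (w : wreath A to) : exists g h, w = wreath_pair g h.
Proof. by case: w => -[g h] gh; exists g, h; apply: val_inj. Qed.

Lemma wreath_act_pair (S : finType) (H A : finGroupType) (to : {action H &-> S})
    (g : H) (h : {dffun forall s : S, A}) v :
  wreath_action A to v (wreath_pair g h) = (to v.1 g, v.2 * h (to v.1 g)).
Proof. by case: v. Qed.

Local Notation T k := (cyclic_tower 6 k).

Lemma tower_faithful k (w w' : level_grp (T k)) :
  (forall s, level_act (T k) s w = level_act (T k) s w') -> w = w'.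
Proof.
elim: k w w' => [|k IHk] w w' eq_w; first by apply: (mulgI (1 : 'Z_6)); apply: (eq_w (1 : 'Z_6)).
have [g [h Dw]] := wreath_pairE w; have [g' [h' Dw']] := wreath_pairE w'.
have eqgh s i : (level_act (T k) s g, i * h (level_act (T k) s g)) =
    (level_act (T k) s g', i * h' (level_act (T k) s g')) :> level (T k) * 'Z_6.
  by have := eq_w (s, i); rewrite Dw Dw'.
have eqg : g = g' by apply: IHk => s; have [] := eqgh s 1.
rewrite Dw Dw' -eqg; congr wreath_pair; apply/ffunP => s.
have /(congr1 snd) := eqgh (level_act (T k) s g^-1) 1.
by rewrite -eqg actKV; apply: (mulgI (1 : 'Z_6)).
Qed.

Lemma tower_transitive k (s t : level (T k)) : exists w, level_act (T k) s w = t.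
Proof.
elim: k s t => [|k IHk] s t; first by exists (s^-1 * t); apply: mulKVg.
case: s t => [s i] [t j]; have [g Dt] := IHk s t.
exists (wreath_pair g [ffun=> i^-1 * j]).
by rewrite [LHS]wreath_act_pair /= Dt ffunE mulKVg.
Qed.

End WreathActions.

(** * Sixth roots of unity and the iterates of [y ^ 6 + a] *)

Section SixthRoots.

Variables (K : fieldType) (iota : {rmorphism {poly 'F_7} -> K}).
Hypothesis iota_inj : injective iota.
Hypothesis iota_frac :
  forall z, exists p q, iota q != 0 /\ z = iota p / iota q.
Variable L : splittingFieldType K.

Local Notation base := (base iota L).
Local Notation integral := (integral iota).
Local Notation G := ('Gal({:L} / 1%AS))%g.

Definition param : L := base 'X.
Definition zeta : L := base 3%:P.
Definition step (y : L) : L := y ^+ 6 + param.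

Lemma zeta_prim : 6.-primitive_root zeta.
Proof.
(* 3 generates the multiplicative group modulo 7. *)
have p3 : 6.-primitive_root (3 : 'F_7).
  apply/andP; split=> //; apply/forallP=> i; rewrite unity_rootE.
  by case: i; do 6?[case=> //].
have inj3 : injective (base \o @polyC _).
  by apply: inj_comp; [apply: base_inj | apply: polyC_inj].
by have := fmorph_primitive_root (base \o @polyC _) 6 3; rewrite p3.
Qed.

Lemma zetaX6 i : (zeta ^+ i) ^+ 6 = 1.
Proof. by rewrite exprAC (prim_expr_order zeta_prim) expr1n. Qed.

Lemma zeta_neq0 i : zeta ^+ i != 0.
Proof. by rewrite expf_neq0 // (prim_root_eq0 zeta_prim). Qed.

Lemma zeta_gal (s : gal_of {:L}) i : s \in G -> s (zeta ^+ i) = zeta ^+ i.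
Proof. by move=> Gs; rewrite rmorphXn /= gal_base. Qed.

Lemma gal_zetaM (s : gal_of {:L}) i y :
  s \in G -> s (zeta ^+ i * y) = zeta ^+ i * s y.
Proof. by move=> Gs; rewrite rmorphM /= zeta_gal. Qed.

Lemma zeta_mod i : zeta ^+ (i %% 6) = zeta ^+ i.
Proof. exact: prim_expr_mod zeta_prim i. Qed.

(** The group law of ['Z_6] is addition modulo 6. *)
Lemma zetaD (i j : 'Z_6) : zeta ^+ (i * j)%g = zeta ^+ i * zeta ^+ j.
Proof. by rewrite -exprD -[RHS]zeta_mod. Qed.

Lemma zeta_inj (i j : 'Z_6) : zeta ^+ i = zeta ^+ j -> i = j.
Proof.
move/eqP; rewrite (eq_prim_root_expr zeta_prim) !modn_small ?ltn_ord //.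
by move/eqP/val_inj.
Qed.

Lemma prod_sixth b : b != 0 ->
  \prod_(i : 'Z_6) ('X - (zeta ^+ i * b)%:P) = 'X^6 - (b ^+ 6)%:P.
Proof.
move=> b0; pose rs := [seq zeta ^+ (i : 'Z_6) * b | i <- index_enum 'Z_6].
have mon : lead_coef ('X^6 - (b ^+ 6)%:P) = 1 by apply/eqP/monicXnsubC.
have := @all_roots_prod_XsubC _ ('X^6 - (b ^+ 6)%:P) rs.
rewrite mon scale1r big_map => -> //.
- by rewrite size_XnsubC // size_map /index_enum -enumT size_enum_ord.
- apply/allP => _ /mapP[i _ ->]; rewrite /root !hornerE.
  by rewrite exprMn zetaX6 mul1r subrr.
rewrite uniq_rootsE map_inj_uniq ?index_enum_uniq // => i j /(mulIf b0).
exact: zeta_inj.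
Qed.

Lemma eq_sixth x y : x ^+ 6 = y ^+ 6 -> exists i : 'Z_6, x = zeta ^+ i * y.
Proof.
move=> Dx; have [y0|y0] := eqVneq y 0.
  exists 0; rewrite y0 mulr0; apply/eqP; move/eqP: Dx.
  by rewrite y0 expr0n expf_eq0.
have : root ('X^6 - (y ^+ 6)%:P) x by rewrite /root !hornerE Dx subrr.
rewrite -prod_sixth //.
rewrite -(big_map (fun i : 'Z_6 => zeta ^+ i * y) xpredT (fun c => 'X - c%:P)).
by rewrite root_prod_XsubC => /mapP[i _ ->]; exists i.
Qed.

(** Composing on the inside lets each linear factor at one level split into six at the next. *)
Fixpoint iter_poly k : {poly L} :=
  if k is k'.+1 then iter_poly k' \Po ('X^6 + param%:P) else 'X.

Lemma horner_iter_poly k x : (iter_poly k).[x] = iter k step x.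
Proof.
elim: k x => [|k IHk] x; first by rewrite hornerX.
by rewrite iterSr -IHk /= horner_comp !hornerE.
Qed.

Lemma iter_step0 k : iter k step 0 = base (crit k).
Proof.
elim: k => [|k IHk]; first by rewrite rmorph0.
by rewrite iterS IHk [crit _]/= rmorphD rmorphXn.
Qed.

(** The critical value is never a root of an iterate, so every root has six distinct children. *)
Lemma iter_step_param k : iter k step param != 0.
Proof.
have -> : iter k step param = iter k.+1 step 0.
  by rewrite iterSr /step expr0n add0r.
by rewrite iter_step0 -(rmorph0 base) (inj_eq (base_inj iota_inj (L := L))) crit_neq0.
Qed.

Lemma step_gal (s : gal_of {:L}) y : s \in G -> s (step y) = step (s y).
Proof. by move=> Gs; rewrite /step rmorphD rmorphXn /= gal_base. Qed.

Lemma iter_step_gal (s : gal_of {:L}) k y :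
  s \in G -> s (iter k step y) = iter k step (s y).
Proof. by move=> Gs; elim: k => //= k IHk; rewrite step_gal // IHk. Qed.

Lemma eq_step x y : step x = step y -> exists i : 'Z_6, x = zeta ^+ i * y.
Proof. by move/addIr/eq_sixth. Qed.

Lemma integral_iter_root k y : iter k step y = 0 -> integral y.
Proof.
elim: k y => [|k IHk] y; first by move=> /= ->; apply: integral0.
rewrite iterSr => /IHk Iy; apply: (@integral_root_monic _ _ _ y ('X^6 - (y ^+ 6)%:P)).
- exact: monicXnsubC.
- by rewrite /root !hornerE subrr.
apply/integral_poly => i; rewrite coefB coefXn coefC.
apply: integral_sub; first exact: integral_nat.
case: ifP => _; last exact: integral0.
have -> : y ^+ 6 = step y - param by rewrite addrK.
by apply: integral_sub => //; apply: integral_base.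
Qed.

Variable n : nat.
Hypothesis n_gt0 : (0 < n)%N.
Hypothesis preimage :
  forall k x, (k < n)%N -> iter k step x = 0 -> exists y, step y = x.
Hypothesis generated : exists2 rs,
  forall x, x \in rs -> iter n step x = 0 & <<1 & rs>>%VS = {:L}%VS.

Lemma gal_trivial (s : gal_of {:L}) : s \in G ->
  (forall y, iter n step y = 0 -> s y = y) -> s = 1%g.
Proof.
move=> Gs fix_s; have [rs rs0 Drs] := generated.
have sub : (<<1 & rs>> <= fixedField [set s])%VS.
  apply/Fadjoin_seqP; split=> [|x /rs0 x0].
    exact: sub1v.
  by apply/fixedFieldP; rewrite ?memvf // => t /set1P->; apply: fix_s.
apply/eqP/gal_eqP => x _; rewrite gal_id.
have : x \in fixedField [set s] by rewrite (subvP sub) // Drs memvf.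
by move/(fixedFieldP (memvf x)); apply; rewrite set11.
Qed.

(** Tameness. An element of order 7 that fixes the parent of [y] multiplies [y] by some [zeta ^+ i];
    its seventh power does the same, because [7 = 1] modulo 6, and is trivial. *)
Lemma gal_pchar' : ~~ (7 %| #|G|)%N.
Proof.
apply/negP => /(Cauchy (isT : prime 7))[s Gs s7].
suff s1 : s = 1%g by rewrite s1 order1 in s7.
have Gsk k : (s ^+ k)%g \in G by rewrite groupX.
suff fix_s k y : iter k step y = 0 -> s y = y by apply: gal_trivial => // y; apply: fix_s.
elim: k y => [|k IHk] y; first by move=> /= ->; rewrite rmorph0.
rewrite iterSr => /IHk; rewrite step_gal // => /eq_step[i Ds].
have Dk l : (s ^+ l)%g y = (zeta ^+ i) ^+ l * y.
  elim: l => [|l IHl]; first by rewrite expg0 gal_id mul1r.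
  by rewrite expgSr galM ?memvf // IHl rmorphM rmorphXn /= zeta_gal // Ds mulrA exprSr.
have s71 : (s ^+ 7 = 1)%g by rewrite -s7 expg_order.
by have := Dk 7; rewrite s71 gal_id exprS zetaX6 mulr1 -Ds => <-.
Qed.

(** * Congruences between roots modulo a prime *)

Section Congruence.

Variables (r : {poly 'F_7}) (m : L -> Prop).
Hypotheses (irr : irreducible_poly r) (Pm : prime_over iota r m).

Lemma primeX x k : integral x -> m (x ^+ k) -> m x.
Proof.
move=> Ix; elim: k => [/(prime1 irr Pm)|k IHk] //.
rewrite exprS => /(primeM Pm Ix) [] //.
by elim: (k) => [|l IHl]; [apply: integral1 | rewrite exprS; apply: integral_mul].
Qed.

(** The difference is [y] times the nonzero constant [zeta ^+ i - 1], which lies outside [m]. *)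
Lemma prime_zeta i y : integral y -> zeta ^+ i * y != y ->
  m (zeta ^+ i * y - y) -> m y.
Proof.
move=> Iy neq; rewrite -{2}[y]mul1r -mulrBl => mz.
have Dz : zeta ^+ i - 1 = base (3 ^+ i - 1)%:P.
  by rewrite polyCB polyC_exp rmorphB rmorphXn rmorph1.
case: (primeM Pm _ Iy mz) => //; first by rewrite Dz; apply: integral_base.
rewrite Dz; have := @prime_const _ _ _ _ _ _ irr Pm (3 ^+ i - 1).
case: eqVneq => [D0|_ /(_ isT) //]; case/eqP: neq.
by move/eqP: Dz; rewrite D0 rmorph0 subr_eq0 => /eqP->; rewrite mul1r.
Qed.

Lemma prime_step x y : integral x -> integral y ->
  m (x - y) -> m (step x - step y).
Proof.
move=> Ix Iy mxy; have -> : step x - step y = x ^+ 6 - y ^+ 6.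
  by rewrite /step opprD addrACA subrr addr0.
exact: (prime_congX Pm).
Qed.

Lemma integral_step y : integral y -> integral (step y).
Proof.
move=> Iy; apply: integral_add; last exact: integral_base.
by rewrite !exprS expr0; do 6?apply: integral_mul => //; apply: integral1.
Qed.

Lemma prime_iter k x y : integral x -> integral y ->
  m (x - y) -> m (iter k step x - iter k step y).
Proof.
move=> + + mxy; elim: k x y mxy => // k IHk x y mxy Ix Iy.
by rewrite !iterSr; apply: IHk; [apply: prime_step | apply: integral_step..].
Qed.

(* Two distinct roots of an iterate that are congruent modulo [m] have ancestors
   [x] and [zeta ^+ i * x] that are congruent, so [x] lies in [m] and [m]
   contains a term of the critical orbit. *)
Lemma congruent_roots k x y :
    (forall l, (0 < l <= k)%N -> ~~ (r %| crit l)) ->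
    iter k step x = 0 -> iter k step y = 0 -> m (x - y) -> x = y.
Proof.
elim: k x y => [|k IHk] x y nr x0 y0 mxy; first by rewrite (x0 : x = 0) (y0 : y = 0).
have [Ix Iy] := (integral_iter_root x0, integral_iter_root y0).
have /eq_step[i Dx] : step x = step y.
  apply: IHk; rewrite -?iterSr //; last exact: prime_step.
  by move=> l /andP[l0 lk]; apply: nr; rewrite l0 leqW.
apply/eqP; apply: contraT => neq; have my : m y.
  by apply: (@prime_zeta i); rewrite -?Dx.
have /negP[] := nr k.+1 (leqnn _); apply/(prime_base Pm).
rewrite -iter_step0 -[iter _ _ 0]subr0 -{2}y0 -opprB; apply: (primeN Pm).
by apply: prime_iter; rewrite ?subr0 //; apply: integral0.
Qed.

End Congruence.

Lemma sixth_root_choice : exists f : L -> L,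
  forall k x, (k < n)%N -> iter k step x = 0 -> step (f x) = x.
Proof.
have /boolp.choice[f Hf] (x : L) : exists y, (exists z, step z = x) -> step y = x.
  by case: (boolp.EM (exists z, step z = x)) => [[z <-]|no]; [exists z | exists 0].
by exists f => k x kn x0; apply: Hf; apply: preimage x0.
Qed.

(** * Labelling the roots by the vertices of the tree *)

Section Tree.

Variable f : L -> L.
Hypothesis step_f : forall k x, (k < n)%N -> iter k step x = 0 -> step (f x) = x.

Local Notation T k := (cyclic_tower 6 k).

(** The function [f] chooses one child of each root; its siblings are numbered by powers of [zeta].
    The index is shifted: [vertex k] labels the roots of the iterate [k.+1]. *)
Fixpoint vertex k : level (T k) -> L :=
  match k with
  | 0 => fun i : 'Z_6 => zeta ^+ i * f 0
  | k'.+1 => fun v : level (T k') * 'Z_6 => zeta ^+ v.2 * f (vertex v.1)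
  end.

Lemma step_zeta i y : step (zeta ^+ i * y) = step y.
Proof. by rewrite /step exprMn zetaX6 mul1r. Qed.

Lemma vertex_root k (s : level (T k)) : (k < n)%N -> iter k.+1 step (vertex s) = 0.
Proof.
elim: k s => [|k IHk] s lt_kn; first by rewrite /= step_zeta (step_f n_gt0).
have {}IHk := IHk s.1 (ltnW lt_kn).
by rewrite iterSr /= step_zeta (step_f lt_kn IHk).
Qed.

Lemma f_neq0 k x : (k < n)%N -> iter k step x = 0 -> f x != 0.
Proof.
move=> lt_kn x0; have Dx := step_f lt_kn x0.
apply: contraTneq isT => f0; move: Dx; rewrite f0 /step expr0n add0r => Dx.
by have := iter_step_param k; rewrite Dx x0 eqxx.
Qed.

Lemma vertex_prod k : (k < n)%N ->
  \prod_(s : level (T k)) ('X - (vertex s)%:P) = iter_poly k.+1.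
Proof.
elim: k => [|k IHk] lt_kn.
  rewrite /= (prod_sixth (f_neq0 (k := 0) n_gt0 _)) // comp_polyX.
  have := step_f (k := 0) n_gt0 (erefl _); rewrite /step => /eqP.
  by rewrite addr_eq0 => /eqP->; rewrite polyCN opprK.
rewrite [RHS]/= -/(iter_poly k.+1) -IHk ?(ltnW lt_kn) // rmorph_prod.
rewrite -(pair_bigA _ (fun s (i : 'Z_6) => 'X - (zeta ^+ i * f (vertex s))%:P)) /=.
apply: eq_bigr => s _; have s0 := vertex_root s (ltnW lt_kn).
rewrite (prod_sixth (f_neq0 lt_kn s0)) rmorphB /= comp_polyX comp_polyC.
rewrite -{2}(step_f lt_kn s0) /step polyCD; ring.
Qed.

Lemma vertex_inj k : (k < n)%N -> injective (@vertex k).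
Proof.
elim: k => [|k IHk] lt_kn.
  by move=> i j /= /(mulIf (f_neq0 (k := 0) n_gt0 (erefl _)))/zeta_inj.
move=> [s i] [t j] /= E; have s0 := vertex_root s (ltnW lt_kn).
have t0 := vertex_root t (ltnW lt_kn).
have Dst : s = t.
  apply: (IHk (ltnW lt_kn)); rewrite -(step_f lt_kn s0) -(step_f lt_kn t0).
  by rewrite -(step_zeta i) E step_zeta.
by move: E; rewrite Dst => /(mulIf (f_neq0 lt_kn t0))/zeta_inj->.
Qed.

Lemma vertex_surj k y : (k < n)%N -> iter k.+1 step y = 0 -> exists s : level (T k), y = vertex s.
Proof.
move=> lt_kn y0; have : root (iter_poly k.+1) y by rewrite /root horner_iter_poly y0.
rewrite -vertex_prod // -(big_map (@vertex k) xpredT (fun c => 'X - c%:P)).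
by rewrite root_prod_XsubC => /mapP[s _ ->]; exists s.
Qed.

Lemma level_roots k : (k <= n)%N -> exists rs, iter_poly k = \prod_(x <- rs) ('X - x%:P).
Proof.
case: k => [_|k lt_kn]; first by exists [:: 0]; rewrite big_seq1 subr0.
by exists (codom (@vertex k)); rewrite -vertex_prod // big_map /index_enum -enumT.
Qed.

Lemma iter_galois : galois 1 {:L}.
Proof.
have [rs rs0 Drs] := generated; case Dn: n n_gt0 => [//|k] _.
have lt_kn : (k < n)%N by rewrite Dn.
have Dp : iter_poly n = \prod_(x <- codom (@vertex k)) ('X - x%:P).
  by rewrite Dn -vertex_prod // big_map /index_enum -enumT.
apply/splitting_galoisField; exists (iter_poly n); split.
- elim: (n) => [|l IHl] /=; first exact: polyOverX.
  apply: polyOver_comp => //; rewrite rpredD ?polyOverXn //.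
  by rewrite polyOverC /param /= rpredZ // mem1v.
- rewrite Dp separable_prod_XsubC map_inj_uniq ?enum_uniq //.
  exact: vertex_inj.
exists (codom (@vertex k)); first by rewrite Dp eqpxx.
apply/eqP; rewrite eqEsubv subvf /=.
suff : (<<1 & rs>> <= <<1 & codom (@vertex k)>>)%VS by rewrite Drs.
apply/Fadjoin_seqP; split=> [|x /rs0 x0]; first exact: subv_adjoin_seq.
apply: seqv_sub_adjoin; have [|s ->] := @vertex_surj k x lt_kn; first by rewrite -Dn.
exact: codom_f.
Qed.

(* At a simple primitive factor [r] of the critical orbit, the inertia group acts
   faithfully on a single root [b] of [step ^ (k+1)] in the prime [m] above [r],
   and [b ^ 6] generates the same ideal as [r] locally. If inertia had order
   less than 6, some [b ^ d] with [d < 6] would be an element of [m] in the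
   inertia field, hence locally a multiple of [r], that is, of [b ^ 6]. *)
Lemma inertia_generator k : (k < n)%N ->
  exists b (s : gal_of {:L}), [/\ iter k.+1 step b = 0, s \in G, s b = zeta * b &
    forall y, iter k.+1 step y = 0 -> y ^+ 6 != b ^+ 6 -> s y = y].
Proof.
move=> lt_kn; have [r [w [irr Dr nrw prim]]] := crit_primitive_factor (ltn0Sn k).
have [m Pm] := prime_over_exists iota_inj iota_frac L irr.
have nr l : (0 < l <= k)%N -> ~~ (r %| crit l) by move=> lk; apply: prim.
have [rs Drs] := level_roots (ltnW lt_kn).
have rs0 x : x \in rs -> iter k step x = 0.
  by move=> rs_x; rewrite -horner_iter_poly Drs; apply/rootP; rewrite root_prod_XsubC.
(* The product is the k-th iterate evaluated at the critical value, that is [crit k.+1]. So some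
   parent [x0] is congruent to [param], and its child [b] lies in [m]. *)
have Da : \prod_(x <- rs) (param - x) = base r * base w.
  rewrite -rmorphM -Dr -iter_step0 iterSr /step expr0n add0r -horner_iter_poly Drs.
  by rewrite horner_prod; apply: eq_bigr => x _; rewrite !hornerE.
have Iparam : integral param by apply: integral_base.
have Irs x : x \in rs -> integral x by move/rs0; apply: integral_iter_root.
have [x0 rs_x0 mx0] : exists2 x, x \in rs & m (param - x).
  apply: boolp.contrapT => no.
  have : m (\prod_(x <- rs) (param - x)).
    by rewrite Da mulrC; apply: (prime_mul Pm); [apply: integral_base | apply/(prime_base Pm)].
  rewrite big_seq; apply: (prime_prodN irr Pm) => x rs_x; split.
    by apply: integral_sub => //; apply: Irs.
  by move=> mx; apply: no; exists x.
set b := f x0; have Db : step b = x0 := step_f lt_kn (rs0 _ rs_x0).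
have b0 : b != 0 := f_neq0 lt_kn (rs0 _ rs_x0).
have Rb : iter k.+1 step b = 0 by rewrite iterSr Db rs0.
have Ib := integral_iter_root Rb.
have IbX d : integral (b ^+ d).
  by elim: d => [|d IHd]; rewrite ?expr0 ?exprS; [apply: integral1 | apply: integral_mul].
have mb : m b.
  apply: (primeX irr Pm (k := 6)) => //.
  have -> : b ^+ 6 = - (param - x0) by rewrite -Db /step; ring.
  exact: (primeN Pm).
have [q Iq Dq] : exists2 q, integral q & base r * base w = b ^+ 6 * q.
  exists (- \prod_(x <- rem x0 rs) (param - x)).
    apply: integral_opp; rewrite big_seq; apply: integral_prod => x /mem_rem rs_x.
    by apply: integral_sub => //; apply: Irs.
  by rewrite -Da (big_rem x0) //= mulrN -mulNr -Db /step; congr (_ * _); ring.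
pose I := inertia iota m.
(* Inertia fixes every parent, since distinct roots of the k-th iterate are incongruent modulo
   [m]. *)
have I_root s y : s \in I -> iter k.+1 step y = 0 -> exists i : 'Z_6, s y = zeta ^+ i * y.
  case/inertiaP=> Gs Is y0; apply: eq_step.
  have gy0 : iter k step (step y) = 0 by rewrite -iterSr.
  rewrite -step_gal //; apply: (congruent_roots irr Pm nr _ gy0).
    by rewrite -iter_step_gal // gy0 rmorph0.
  exact/Is/(integral_iter_root gy0).
(* Such an [s] suffices: a root [y] that it moves lies in [m], as [b] does, so their parents are
   congruent, hence equal. *)
have [[s Is sb]|noI] := boolp.EM (exists2 s, s \in I & s b = zeta * b).
  exists b, s; have /inertiaP[Gs Hs] := Is; split=> // y y0 neq.
  have [i Dsy] := I_root s y Is y0; apply/eqP; apply: contraT => neq_y.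
  have Iy := integral_iter_root y0.
  have my : m y.
    by apply: (prime_zeta irr Pm Iy (i := i)); rewrite -Dsy //; apply: Hs.
  case/eqP: neq; apply: (addIr param); apply: (congruent_roots irr Pm nr).
  - by rewrite -iterSr.
  - by rewrite -iterSr.
  by apply: (prime_step Pm) => //; apply: (primeB Pm).
pose J i := exists2 s, s \in I & s b = zeta ^+ i * b.
have JD i j : J i -> J j -> J (i + j)%N.
  case=> s Is sb [t It tb]; have [/inertiaP[Gs _] /inertiaP[Gt _]] := (Is, It).
  have /group_setP[_ IM] := inertia_group_set Pm.
  exists (s * t)%g; first exact: IM.
  by rewrite galM ?memvf // sb rmorphM /= zeta_gal // tb mulrA exprD.
have Jmod i : J i -> J (i %% 6)%N by rewrite /J zeta_mod.
have J1 : ~ J 1 by [].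
have J5 : ~ J 5.
  by move=> j; apply: J1; apply: (Jmod 25); do 4!apply: (JD 5 _ j).
(* The exponents attained form a proper subgroup of the integers modulo 6. It is killed by 2 if it
   contains 3, and otherwise by 3. *)
have [d d06 Hd] : exists2 d, (0 < d < 6)%N &
    forall i : 'Z_6, J i -> (zeta ^+ i) ^+ d = 1.
  case: (boolp.EM (J 3)) => [j3|nj3].
    have J4 : ~ J 4 by move=> j4; apply: J1; apply: (Jmod 7); apply: (JD 3 4).
    have J2 : ~ J 2 by move=> j2; apply: J4; apply: (JD 2 2).
    exists 2 => // i; rewrite -exprM -zeta_mod.
    by case: i => [] [|[|[|[|[|[|//]]]]]] //= _; rewrite -?[(_ %% 6)%N]/0%N ?expr0.
  exists 3 => // i; rewrite -exprM -zeta_mod.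
  by case: i => [] [|[|[|[|[|[|//]]]]]] //= _; rewrite -?[(_ %% 6)%N]/0%N ?expr0.
have [||||c [x [Ic mc Ix Dc]]] :=
  inertia_field_unramified iota_inj iota_frac _ irr Pm (z := b ^+ d).
- exact: iter_galois.
- have -> : d = d.-1.+1 by lia.
  by rewrite exprSr; apply: (prime_mul Pm).
- move=> s Is; have [i Di] := I_root s b Is Rb.
  by rewrite rmorphXn /= Di exprMn Hd ?mul1r //; exists s.
- rewrite -(dvdn_pcharf (pchar_Fp (isT : prime 7))).
  apply: contra gal_pchar' => d7; apply: dvdn_trans d7 _.
  have sIG : inertia_group Pm \subset G by apply/subsetP=> s /inertiaP[].
  exact: cardSg sIG.
(* Eliminate [r] between [r * w = b ^ 6 * q] and [c * b ^ d = r * x]. The right side is in [m]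
   because [d < 6], but neither [w] nor [c] is. *)
have E : base w * c = b ^+ (6 - d) * (q * x).
  apply: (mulfI (expf_neq0 d b0)); rewrite [RHS]mulrA -exprD subnKC; last by lia.
  by rewrite [RHS]mulrA -Dq mulrC -mulrA Dc; ring.
case: (primeM Pm _ Ic (_ : m (base w * c))) => //; first exact: integral_base.
  rewrite E mulrC; apply: (prime_mul Pm); first exact: integral_mul.
  have -> : (6 - d = (5 - d).+1)%N by lia.
  by rewrite exprSr; apply: (prime_mul Pm).
by move/(proj1 (prime_base Pm w)) => rw; rewrite rw in nrw.
Qed.

(** * Galois automorphisms as automorphisms of the tree *)

Lemma step_vertex k (v : level (T k)) (i : 'Z_6) :
  (k.+1 < n)%N -> step (@vertex k.+1 (v, i)) = vertex v.
Proof.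
by move=> lt_kn; rewrite /= step_zeta (step_f lt_kn (vertex_root v (ltnW lt_kn))).
Qed.

Lemma vertex_shift k (v : level (T k)) (i j : 'Z_6) :
  zeta ^+ j * @vertex k.+1 (v, i) = @vertex k.+1 (v, (i * j)%g).
Proof. by rewrite [vertex _]/= mulrA [_ * zeta ^+ i]mulrC -zetaD. Qed.

Definition acts_as k (s : gal_of {:L}) (w : level_grp (T k)) : Prop :=
  forall v, s (vertex v) = vertex (level_act (T k) v w).

Lemma gal_acts k (s : gal_of {:L}) : (k < n)%N -> s \in G ->
  exists w : level_grp (T k), acts_as s w.
Proof.
elim: k => [|k IHk] lt_kn Gs.
  have [|j Dj] := @eq_step (s (f 0)) (f 0).
    by rewrite -step_gal // (step_f n_gt0 (erefl _)) rmorph0.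
  exists j => i; rewrite /= rmorphM /= zeta_gal // Dj mulrA.
  by rewrite -zetaD.
have [g Hg] := IHk (ltnW lt_kn) Gs.
have fP v := step_f lt_kn (vertex_root v (ltnW lt_kn)).
(* As in [wreath_fun], the rotation is recorded at the image vertex, whence the inverse of [g]. *)
have /fin_all_exists[h Hh] (v : level (T k)) : exists j : 'Z_6,
    s (f (vertex (level_act (T k) v g^-1%g))) = zeta ^+ j * f (vertex v).
  by apply: eq_step; rewrite -step_gal // !fP Hg actKV.
exists (wreath_pair g [ffun v => h v]) => -[v i].
rewrite [level_act _ _ _]wreath_act_pair /= rmorphM /= zeta_gal //.
by have := Hh (level_act (T k) v g); rewrite actK => ->; rewrite ffunE mulrA -zetaD.
Qed.

Lemma gal_expg_zeta (s : gal_of {:L}) y l :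
  s \in G -> s y = zeta * y -> (s ^+ l)%g y = zeta ^+ l * y.
Proof.
move=> Gs Ds; elim: l => [|l IHl]; first by rewrite expg0 gal_id mul1r.
by rewrite expgSr galM ?memvf // IHl rmorphM /= zeta_gal // Ds mulrA exprSr.
Qed.

(** This realizes the kernel of restriction to the previous level. Conjugates of the inertia
    generator rotate one chosen sibling set each, and their powers multiply to any [h]. *)
Lemma realizes_shift k (h : level (T k) -> 'Z_6) : (k.+1 < n)%N ->
    (forall w : level_grp (T k), exists2 s, s \in G & acts_as s w) ->
  exists2 s : gal_of {:L}, s \in G & forall (v : level (T k)) (i : 'Z_6),
    s (@vertex k.+1 (v, i)) = zeta ^+ h v * @vertex k.+1 (v, i).
Proof.
move=> lt_kn real.
have single (t : level (T k)) : exists2 s : gal_of {:L}, s \in G &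
    forall (v : level (T k)) (i : 'Z_6),
    s (@vertex k.+1 (v, i)) = zeta ^+ (v == t) * @vertex k.+1 (v, i).
  have [b [s [b0 Gs sb Hs]]] := inertia_generator lt_kn.
  have [[t' j] Db] := vertex_surj lt_kn b0.
  (* [s'] carries [t] to the parent [t'] of [b], so conjugation moves the rotation from above [t']
     to above [t]. *)
  have [w Dt'] := tower_transitive t t'; have [s' Gs' Hs'] := real w.
  exists (s' * s * s'^-1)%g; first by rewrite !groupM ?groupV.
  move=> v i; rewrite !galM ?memvf //; set y := vertex _; set y' := s' y.
  have step_y' : step y' = vertex (level_act (T k) v w).
    by rewrite -step_gal // step_vertex // Hs'.
  have y'0 : iter k.+2 step y' = 0.
    by rewrite -iter_step_gal // vertex_root // rmorph0.
  have Dy : y = s'^-1%g y' by rewrite -galM ?memvf // mulgV gal_id.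
  have step_b : step b = vertex t' by rewrite Db step_vertex.
  case: eqVneq => [Dv|neq_vt].
    have [l Dl] : exists l : 'Z_6, y' = zeta ^+ l * b.
      by apply: eq_step; rewrite step_y' step_b Dv Dt'.
    have -> : s y' = zeta * y' by rewrite Dl rmorphM /= zeta_gal // sb mulrCA.
    by rewrite expr1 -[zeta]expr1 rmorphM /= zeta_gal ?groupV // -Dy.
  rewrite Hs ?expr0 ?mul1r -?Dy //; apply: contra neq_vt => /eqP eq6.
  have : step y' = step b by rewrite /step eq6.
  rewrite step_y' step_b => /(vertex_inj (ltnW lt_kn)).
  by rewrite -Dt' => /act_inj->.
suff [s Gs Hs] : exists2 s : gal_of {:L}, s \in G & forall (v : level (T k)) (i : 'Z_6),
    s (@vertex k.+1 (v, i)) =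
      zeta ^+ (if v \in enum (level (T k)) then h v : nat else 0) * @vertex k.+1 (v, i).
  by exists s => // v i; rewrite Hs mem_enum.
elim: (enum _) (enum_uniq (level (T k))) => [|t l IHl] /=.
  by exists 1%g => [|v i]; rewrite ?group1 // gal_id mul1r.
case/andP=> nlt /IHl[s Gs Hs]; have [s' Gs' Hs'] := single t.
exists (s * s' ^+ h t)%g => [|v i]; first by rewrite groupM ?groupX.
rewrite galM ?memvf // Hs gal_zetaM ?groupX // inE.
have := Hs' v i; case: eqVneq => [->|neq_vt] /= Ds'.
  by rewrite (negPf nlt) mul1r (gal_expg_zeta _ Gs').
have -> : (s' ^+ h t)%g (@vertex k.+1 (v, i)) = @vertex k.+1 (v, i).
  rewrite expr0 mul1r in Ds'; elim: (nat_of_ord (h t)) => [|m IHm].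
    by rewrite expg0 gal_id.
  by rewrite expgSr galM ?memvf // IHm.
by [].
Qed.

Lemma gal_realizes k (w : level_grp (T k)) : (k < n)%N ->
  exists2 s : gal_of {:L}, s \in G & acts_as s w.
Proof.
elim: k w => [|k IHk] w lt_kn.
  have [b [s [b0 Gs sb _]]] := inertia_generator lt_kn.
  have [i0 Db] := @vertex_surj 0 b lt_kn b0.
  have sf : s (f 0) = zeta * f 0.
    apply: (mulfI (zeta_neq0 i0)); rewrite mulrCA -[_ * f 0]Db -sb Db /=.
    by rewrite rmorphM /= zeta_gal.
  exists (s ^+ (w : 'Z_6))%g => [|i]; first exact: groupX.
  rewrite [vertex _]/= gal_zetaM ?groupX // gal_expg_zeta //.
  by rewrite mulrA -zetaD.
have [g [h Dw]] := wreath_pairE w.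
have [s Gs Hs] := IHk g (ltnW lt_kn).
have [w0 Hw0] := gal_acts lt_kn Gs; have [g0 [h0 Dw0]] := wreath_pairE w0.
have eqg v : level_act (T k) v g0 = level_act (T k) v g.
  apply: (vertex_inj (ltnW lt_kn)); rewrite -Hs.
  rewrite -(step_vertex v 1%g lt_kn) step_gal // Hw0 Dw0.
  by rewrite [level_act (T k.+1) _ _]wreath_act_pair step_vertex.
(* The lift [s] of [g] acts with rotations [h0]; the shift corrects them to [h]. *)
have [s' Gs' Hs'] := realizes_shift (fun v => (h0 v)^-1 * h v)%g lt_kn
  (fun w' => IHk w' (ltnW lt_kn)).
exists (s * s')%g => [|[v i]]; first exact: groupM.
rewrite galM ?memvf // Hw0 Dw0 Dw [level_act (T k.+1) _ _]wreath_act_pair.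
rewrite [X in _ = vertex X]wreath_act_pair Hs' vertex_shift eqg.
by rewrite -[in LHS]mulgA mulKVg.
Qed.

Theorem gal_isog_tower k : n = k.+1 -> G \isog [set: level_grp (T k)].
Proof.
move=> Dn; have lt_kn : (k < n)%N by rewrite Dn.
have /boolp.choice[phi Hphi] (s : gal_of {:L}) : exists w : level_grp (T k),
    s \in G -> acts_as s w.
  case: (boolP (s \in G)) => [Gs|_]; last by exists 1%g.
  by have [w Hw] := gal_acts lt_kn Gs; exists w.
have phiM : {in G &, {morph phi : s t / (s * t)%g}}.
  move=> s t Gs Gt; apply: tower_faithful => v; apply: (vertex_inj lt_kn).
  by rewrite actM -!Hphi ?groupM // galM ?memvf.
apply/isogP; exists (Morphism phiM) => /=.
  apply/injmP => s t Gs Gt /= eq_phi; apply/eqP; rewrite eq_mulgV1; apply/eqP.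
  apply: gal_trivial => [|y]; first by rewrite groupM ?groupV.
  rewrite {1}Dn => /(vertex_surj lt_kn)[v ->].
  by rewrite galM ?memvf // Hphi // eq_phi -Hphi // -galM ?memvf // mulgV gal_id.
apply/setP=> w; rewrite inE; have [s Gs Hs] := gal_realizes w lt_kn.
apply/morphimP; exists s => //=; apply: tower_faithful => v.
by apply: (vertex_inj lt_kn); rewrite -Hs Hphi.
Qed.

End Tree.

End SixthRoots.

(** * Change of variables *)

Lemma fraction_ratio (R : idomainType) (z : {fraction R}) :
  exists n d, tofrac d != 0 /\ z = tofrac n / tofrac d.
Proof.
elim/quotW: z => x; exists (frac x).1, (frac x).2.
have d0 : tofrac (frac x).2 != 0 by rewrite tofrac_eq0 denom_ratioP.
split=> //; apply: (canRL (mulfK d0)).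
change (FracField.mul (\pi x)%qT (tofrac (frac x).2) = tofrac (frac x).1).
rewrite !piE /FracField.mulf !numden_Ratio ?oner_eq0 //.
apply/eqmodP; rewrite /= FracField.equivfE.
by rewrite !numden_Ratio ?mulf_neq0 ?oner_eq0 ?denom_ratioP // !mulr1 mulrC.
Qed.

Lemma div_expM (E : fieldType) (x y : E) i k : y != 0 -> (i <= k)%N ->
  (x / y) ^+ i * y ^+ k = x ^+ i * y ^+ (k - i).
Proof.
move=> y0 le_ik; have -> : y ^+ k = y ^+ i * y ^+ (k - i) by rewrite -exprD subnKC.
by rewrite mulrA -exprMn divfK.
Qed.

Lemma moebius_ratio (F E : fieldType) (phi psi : {rmorphism {poly F} -> E}) :
    (forall z, exists n d, psi d != 0 /\ z = psi n / psi d) ->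
    (forall c, phi c%:P = psi c%:P) -> psi 'X + 1 != 0 ->
    phi 'X = psi 'X / (psi 'X + 1) ->
  forall z, exists p q, phi q != 0 /\ z = phi p / phi q.
Proof.
move=> psi_frac phiC u0 phiX.
pose Q z := exists p q, phi q != 0 /\ z = phi p / phi q.
have Qp p : Q (phi p) by exists p, 1; rewrite rmorph1 divr1 oner_neq0.
have QM x y : Q x -> Q y -> Q (x * y).
  case=> p [q [q0 ->]] [p' [q' [q'0 ->]]]; exists (p * p'), (q * q').
  by rewrite !rmorphM mulf_neq0 // mulf_div.
have QD x y : Q x -> Q y -> Q (x + y).
  case=> p [q [q0 ->]] [p' [q' [q'0 ->]]]; exists (p * q' + p' * q), (q * q').
  by rewrite rmorphD !rmorphM mulf_neq0 // addf_div.
have QV x : Q x -> Q x^-1.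
  case=> p [q [q0 ->]]; case: (eqVneq (phi p) 0) => [p0|p0].
    by rewrite p0 mul0r invr0 -(rmorph0 phi).
  by exists q, p; rewrite invf_div.
have QX : Q (psi 'X).
  (* Inverse of the Moebius map: [a = x / (x + 1)] gives [x = a / (1 - a)]. *)
  have -> : psi 'X = phi 'X * (phi (1 - 'X))^-1.
    rewrite rmorphB rmorph1 phiX; move: (psi 'X) u0 => x u0.
    have -> : 1 - x / (x + 1) = (x + 1)^-1 by field.
    by rewrite invrK divfK.
  exact/QM/QV.
have Qpsi p : Q (psi p).
  elim/poly_ind: p => [|p c IHp]; first by rewrite rmorph0 -(rmorph0 phi).
  by rewrite rmorphD rmorphM -phiC; apply: QD => //; apply: QM.
by move=> z; have [n [d [_ ->]]] := psi_frac z; apply: QM => //; apply: QV.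
Qed.

(** * The field [F_7(t)] as rational functions in [t / (t + 1)] *)

Section Reparametrization.

Local Notation K := {fraction {poly 'F_7}}.
Local Notation t := (ratvar 'F_7).
Local Notation u := (t + 1).

Lemma u_neq0 : u != 0.
Proof.
have -> : u = tofrac ('X + 1) by rewrite tofracD tofrac1.
by rewrite tofrac_eq0 -size_poly_eq0 -(polyC1) size_XaddC.
Qed.

(* [K] is also the field of rational functions in [t / (t + 1)], the critical
   value after conjugating [f_c] to a monic polynomial. *)
Definition reparam : {rmorphism {poly 'F_7} -> K} :=
  horner_eval (t / u) \o map_poly (@tofrac _ \o polyC).

Lemma reparamX : reparam 'X = t / u.
Proof. by rewrite /= /horner_eval map_polyX hornerX. Qed.

Lemma reparamE (p : {poly 'F_7}) k : (size p <= k.+1)%N ->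
  reparam p * u ^+ k =
    tofrac (\sum_(i < size p) p`_i *: ('X ^+ i * ('X + 1) ^+ (k - i))).
Proof.
move=> le_pk; rewrite /= /horner_eval horner_coef size_map_poly mulr_suml rmorph_sum.
apply: eq_bigr => i _; have le_ik : (i <= k)%N by rewrite -ltnS; apply: leq_trans le_pk.
rewrite coef_map /= -mul_polyC !rmorphM !rmorphXn /= rmorphD rmorph1 -/t.
by rewrite -mulrA div_expM // u_neq0.
Qed.

Lemma reparam_inj : injective reparam.
Proof.
apply: raddf_inj => p p0; apply/eqP; apply: contraT => nz_p.
have Dn : size p = (size p).-1.+1 by rewrite prednK // size_poly_gt0.
have := @reparamE p (size p).-1; rewrite {1}Dn p0 mul0r => /(_ (leqnn _))/esym/eqP.
(* At -1, the zero of ['X + 1], only the leading term survives. *)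
rewrite tofrac_eq0 => /eqP/(congr1 (fun q => q.[-1])); rewrite horner0 Dn.
rewrite big_ord_recr /= hornerD horner_sum big1 => [|i _].
  rewrite subnn expr0 mulr1 hornerZ hornerXn add0r => /eqP.
  rewrite mulf_eq0 expf_eq0 oppr_eq0 oner_eq0 andbF orbF.
  by rewrite -/(lead_coef p) lead_coef_eq0 (negPf nz_p).
rewrite hornerZ hornerM !horner_exp hornerD hornerX hornerC addNr.
by rewrite -(subnSK (ltn_ord i)) exprS mul0r !mulr0.
Qed.

Lemma reparam_frac z : exists p q, reparam q != 0 /\ z = reparam p / reparam q.
Proof.
apply: (@moebius_ratio _ _ reparam (@tofrac _)) => [|c||].
- exact: fraction_ratio.
- by rewrite /= /horner_eval map_polyC hornerC.
- exact: u_neq0.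
exact: reparamX.
Qed.

End Reparametrization.

(** * Iterates and their splitting fields *)

Section Iterates.

Variables (K : fieldType) (f : {poly K}).
Hypothesis size_f : (1 < size f)%N.

Lemma iter_comp_add m k : iter_comp (m + k) f = iter_comp m f \Po iter_comp k f.
Proof.
elim: m => [|m IHm]; first by rewrite comp_polyX.
by rewrite addSn /iter_comp /= -!/(iter_comp _ _) IHm comp_polyA.
Qed.

Lemma size_iter_comp k : (1 < size (iter_comp k f))%N.
Proof.
elim: k => [|k IHk]; first by rewrite size_polyX.
by rewrite -ltn_predRL [iter_comp _ _]/= size_comp_poly muln_gt0 !ltn_predRL size_f.
Qed.

Variables (L : fieldExtType K).
Local Notation fL := (map_poly (GRing.in_alg L)).

Lemma horner_iter_comp k x :
  (fL (iter_comp k f)).[x] = iter k (fun y => (fL f).[y]) x.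
Proof.
elim: k => [|k IHk]; first by rewrite /= map_polyX hornerX.
by rewrite iterS -IHk [iter_comp _ _]/= map_comp_poly horner_comp.
Qed.

(** The nonconstant polynomial [iter_comp (n - k) f - x] divides the split polynomial
    [iter_comp n f], so it has a root [z]. All but the last application of [f] to [z] gives the
    preimage. *)
Lemma splitting_preimage n rs k x :
    fL (iter_comp n f) %= \prod_(z <- rs) ('X - z%:P) -> (k < n)%N ->
    iter k (fun y => (fL f).[y]) x = 0 ->
  exists y, (fL f).[y] = x.
Proof.
move=> Dn lt_kn x0; pose h := fL (iter_comp (n - k) f) - x%:P.
have : h %| fL (iter_comp n f).
  have Dk : (n = k + (n - k))%N by rewrite subnKC // ltnW.
  have /factor_theorem[q Dq] : root (fL (iter_comp k f)) x.
    by rewrite /root horner_iter_comp x0.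
  rewrite {1}Dk iter_comp_add map_comp_poly Dq comp_polyM comp_polyB.
  by rewrite comp_polyX comp_polyC dvdp_mull.
rewrite (eqp_dvdr _ Dn) => /dvdp_prod_XsubC[m Dh].
have sh : (1 < size h)%N.
  rewrite size_polyDl size_map_poly ?size_iter_comp // size_polyN.
  by rewrite (leq_ltn_trans (size_polyC_leq1 _)) ?size_iter_comp.
have := eqp_size Dh; rewrite size_prod_XsubC.
case: (mask m rs) Dh => [_ sh1|z s Dh _]; first by rewrite sh1 in sh.
have : root h z by rewrite (eqp_root Dh) root_prod_XsubC mem_head.
rewrite /root hornerD hornerN hornerC horner_iter_comp subr_eq0 => /eqP.
have -> : (n - k)%N = (n - k).-1.+1 by lia.
by move=> <-; exists (iter (n - k).-1 (fun y => (fL f).[y]) z).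
Qed.

End Iterates.

Lemma size_unicritical (K : fieldType) (c b : K) d :
  c != 0 -> (0 < d)%N -> size (c *: 'X^d + b%:P) = d.+1.
Proof.
move=> c0 d0; rewrite size_polyDl size_scale // size_polyXn //.
exact: leq_ltn_trans (size_polyC_leq1 b) _.
Qed.

(** The exponent -5 is [1 - 6]: it makes conjugation by the scaling [v] produce a monic
    polynomial. *)
Lemma horner_twist (K : fieldType) (L : fieldExtType K) (b v : K) (y : L) :
  v != 0 ->
  (map_poly (GRing.in_alg L) (v ^- 5 *: 'X^6 + b%:P)).[v%:A * y] =
    v%:A * (y ^+ 6 + (b / v)%:A).
Proof.
move=> v0; rewrite rmorphD /= map_polyZ map_polyXn map_polyC /= !hornerE.
have w0 : GRing.in_alg L v != 0 by rewrite fmorph_eq0.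
rewrite -!/(GRing.in_alg L _) fmorph_div fmorphV rmorphXn /=.
move: w0; rewrite /=; set w := v%:A; set e := b%:A => w0.
by field.
Qed.

Lemma arboreal_maximal_twist (K : fieldType) (iota : {rmorphism {poly 'F_7} -> K})
    (b v : K) :
    injective iota -> (forall z, exists p q, iota q != 0 /\ z = iota p / iota q) ->
    v != 0 -> iota 'X = b / v ->
  arboreal_maximal 6 (v ^- 5 *: 'X^6 + b%:P).
Proof.
move=> iota_inj iota_frac v0 iotaX; set f := _ + _ => n n_gt0 L [rs Drs Lrs].
set U : L := v%:A; have U0 : U != 0 by rewrite /U scaler_eq0 oner_eq0 orbF.
pose h (y : L) := (map_poly (GRing.in_alg L) f).[y].
have hE y : h (U * y) = U * step iota y.
  by rewrite /h horner_twist // /step /param /= iotaX.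
have iterE k y : iter k h (U * y) = U * iter k (step iota (L := L)) y.
  by elim: k => //= k ->.
have iter0 k y : iter k h (U * y) = 0 <-> iter k (step iota (L := L)) y = 0.
  rewrite iterE; split=> [/eqP|->]; last by rewrite mulr0.
  by rewrite mulf_eq0 (negPf U0) => /eqP.
have sf : (1 < size f)%N by rewrite size_unicritical // invr_eq0 expf_neq0.
have pre k x : (k < n)%N -> iter k (step iota (L := L)) x = 0 ->
    exists y, step iota y = x.
  move=> lt_kn /iter0 x0; have [y Dy] := splitting_preimage sf Drs lt_kn x0.
  exists (y / U); apply: (mulfI U0).
  by rewrite -hE mulrC divfK.
have gen : exists2 rs, forall x, x \in rs -> iter n (step iota (L := L)) x = 0 &
    <<1 & rs>>%VS = {:L}%VS.
  exists [seq z / U | z <- rs] => [_ /mapP[z rs_z ->]|].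
    apply/iter0; rewrite mulrC divfK // -horner_iter_comp; apply/rootP.
    by rewrite (eqp_root Drs) root_prod_XsubC.
  apply/eqP; rewrite eqEsubv subvf /=.
  suff : (<<1 & rs>> <= <<1 & [seq z / U | z <- rs]>>)%VS by rewrite Lrs.
  apply/Fadjoin_seqP; split=> [|z rs_z]; first exact: sub1v.
  rewrite -(divfK U0 z) memvM //; first by apply: seqv_sub_adjoin; apply: map_f.
  by rewrite (subvP (sub1v _)) // rpredZ // mem1v.
have [g Hg] := sixth_root_choice pre.
have := gal_isog_tower iota_inj iota_frac n_gt0 gen Hg (k := n.-1).
by rewrite prednK // => /(_ (erefl _)).
Qed.

(** * Torsion of the twisted Carlitz module *)

Lemma carlitz_XaddC1 (F : finFieldType) c :
  carlitz c ('X + 1 : {poly F}) = (ratvar F + 1) *: 'X + c *: 'X^#|F|.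
Proof.
rewrite /carlitz -polyC1 size_XaddC !big_ord_recl big_ord0 /= polyC1.
rewrite !coefD !coefX !coef1 /= add0r addr0 addr0 tofrac1 !scale1r comp_polyXr /carlitz_t.
by rewrite addrA scalerDl scale1r ['X + _]addrC.
Qed.

Lemma carlitzC (F : finFieldType) c (a : F) : a != 0 ->
  carlitz c a%:P = tofrac a%:P *: 'X.
Proof. by move=> a0; rewrite /carlitz size_polyC a0 big_ord1 coefC. Qed.

Lemma in_qpolyC (F : fieldType) (N : {poly F}) (b : F) :
  in_qpoly N b%:P = b%:P :> {poly F}.
Proof.
apply: in_qpoly_small; apply: leq_ltn_trans (size_polyC_leq1 b) _.
exact: size_mk_monic_gt1.
Qed.

(** At [v * i] the two terms are [v ^ 2 * i] and [v ^ 2 * i ^ 7], and [i ^ 7 = - i]. *)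
Lemma torsion_root (K E : fieldType) (iota : {rmorphism K -> E}) (v : K) (i : E) :
    v != 0 -> i ^+ 2 = -1 ->
  root (map_poly iota (v *: 'X + v ^- 5 *: 'X^7)) (iota v * i).
Proof.
move=> v0 i2; have w0 : iota v != 0 by rewrite fmorph_eq0.
rewrite /root rmorphD /= !map_polyZ map_polyX map_polyXn /= fmorphV rmorphXn /=.
rewrite hornerD !hornerZ hornerX hornerXn.
have i7 : i ^+ 7 = - i by rewrite (exprD i 6 1) (exprM i 2 3) i2; ring.
by rewrite exprMn i7; apply/eqP; field.
Qed.

Lemma constant_adelic_unit (F : finFieldType) (a : F) : a != 0 ->
  adelic_unit (fun N => in_qpoly N a%:P).
Proof.
move=> a0; split=> [N _|M N _ _ _]; last by rewrite in_qpolyC.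
by apply: (rmorph_unit (in_qpoly N)); rewrite poly_unitE size_polyC coefC a0 unitfE.
Qed.

Lemma not_adelic_surjective (Ks : fieldType)
    (iota : {rmorphism {fraction {poly 'F_7}} -> Ks}) :
  separable_closure iota -> ~ adelic_surjective ((ratvar 'F_7 + 1) ^- 5) iota.
Proof.
case=> _ closed surj.
have := u_neq0; set v := ratvar 'F_7 + 1 in surj *; move=> v0.
have iv0 : iota v != 0 by rewrite fmorph_eq0.
have c7 : 7%:R = 0 :> Ks.
  rewrite -(rmorph_nat iota) -(rmorph_nat (@tofrac _)) -(rmorph_nat (@polyC _)).
  by rewrite (_ : 7%:R = 0 :> 'F_7) ?rmorph0 //; apply/eqP.
have four0 : 4%:R != 0 :> Ks.
  apply: contraTneq isT => four0; have := oner_neq0 Ks.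
  have -> : 1 = 2%:R * 4%:R - 7%:R :> Ks by ring.
  by rewrite four0 c7 mulr0 subrr eqxx.
have [||i] := closed ('X^2 + 1).
(* ['X^2 + 1] divides the separable polynomial ['X^4 - 1]. *)
- apply: dvdp_separable (separable_Xn_sub_1 four0).
  by apply/dvdpP; exists ('X^2 - 1); ring.
- by rewrite -polyC1 size_XnaddC.
rewrite /root !hornerE addr_eq0 => /eqP i2.
have [s [_ s_fix] s_img] := surj _ (constant_adelic_unit (isT : 3 != 0 :> 'F_7)).
have modX1 : modulus ('X + 1 : {poly 'F_7}).
  by rewrite /modulus -polyC1 size_XaddC monicXaddC.
have := s_img _ modX1 (iota v * i); rewrite carlitz_XaddC1 -/v in_qpolyC carlitzC //.
rewrite card_Fp // => /(_ (torsion_root iota v0 i2)).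
rewrite map_polyZ map_polyX hornerZ hornerX rmorphM s_fix.
have -> : iota (tofrac 3%:P) = 3%:R.
  by rewrite -(rmorph_nat iota) -(rmorph_nat (@tofrac _)) -(rmorph_nat (@polyC _)).
(* Applying [s] to [i ^ 2 = -1] yields [-9 = -1], impossible in characteristic 7. *)
rewrite mulrCA => /(mulfI iv0) si; have := congr1 s i2.
rewrite rmorphXn si exprMn i2 rmorphN1 => /eqP; rewrite -subr_eq0.
have -> : 3%:R ^+ 2 * -1 - -1 = - 1 - 7%:R :> Ks by ring.
by rewrite c7 subr0 oppr_eq0 oner_eq0.
Qed.

Theorem proposition6p4 :
  let K : fieldType := {fraction {poly 'F_7}} in
  let t : K := ratvar 'F_7 in
  let d := 6%N in
  let u : K := t + 1 in
  let c : K := u ^- (d - 1) in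
  arboreal_maximal d (c *: 'X^d + t%:P : {poly K}) /\
  (forall (Ks : fieldType) (iota : {rmorphism K -> Ks}),
     separable_closure iota -> ~ adelic_surjective c iota).
Proof.
split; last exact: not_adelic_surjective.
exact: (arboreal_maximal_twist reparam_inj reparam_frac u_neq0 reparamX).
Qed.
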